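(* Let $\gamma:I\to\mathbb{R}^2$ be a $C^\infty$ curve with $0\in I$. Then $\gamma$ is $\mathcal{A}$-equivalent at $t=0$ to $Cusp_{(4,5)}(t)=(t^4,t^5)$ if and only if $\gamma'(0)=\gamma''(0)=\gamma'''(0)=\mathbf{0}$, $A\neq0$, and $$-77B^2+105AD+60AC=0,$$ where $A,B,C,D$ are as defined in the context.
   Context: $A=\det(\gamma^{(5)}(0),\gamma^{(4)}(0))$, $B=\det(\gamma^{(6)}(0),\gamma^{(4)}(0))$, $C=\det(\gamma^{(7)}(0),\gamma^{(4)}(0))$, $D=\det(\gamma^{(6)}(0),\gamma^{(5)}(0))$, where $\det(u,v)$ is the determinant of the $2\times2$ matrix with columns $u,v$. $\mathcal{A}$-equivalence: existence of $C^\infty$ diffeomorphism germs $\psi$ of $(\mathbb{R},0)$ and $\Psi$ of $\mathbb{R}^2$ with $\Psi\circ\gamma_1\circ\psi^{-1}=\gamma_2$. *)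

(* Defs.v *)
From HB Require Import structures.
From mathcomp Require Import all_boot all_order all_algebra.
From mathcomp Require Import all_classical all_reals all_analysis.
Set Implicit Arguments. Unset Strict Implicit. Unset Printing Implicit Defensive.
Import Order.TTheory GRing.Theory Num.Theory.
Import numFieldNormedType.Exports.
Local Open Scope classical_set_scope.
Local Open Scope ring_scope.

Section Defs.
Variable R : realType.

Fixpoint iderive {V W : normedModType R} (vs : seq V) (f : V -> W) : V -> W :=
  match vs with
  | [::] => f
  | v :: vs' => fun x => derive (iderive vs' f) x v
  end.

Definition smooth_on {V W : normedModType R} (U : set V) (f : V -> W) : Prop :=
  forall (vs : seq V) (x : V), U x ->
    {for x, continuous (iderive vs f)} /\
    (forall v : V, derivable (iderive vs f) x v).

Definition kder (k : nat) (g : R -> 'rV[R]_2) (t : R) : 'rV[R]_2 :=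
  iderive (nseq k (1 : R)) g t.

Definition det2 (u v : 'rV[R]_2) : R := u 0 0 * v 0 1 - v 0 0 * u 0 1.

Definition diffeo_germ_with {V : normedModType R} (p : V) (f g : V -> V) : Prop :=
  exists (U W : set V),
    [/\ open U /\ open W, U p, smooth_on U f /\ smooth_on W g,
        (forall x, U x -> W (f x) /\ g (f x) = x) &
        (forall y, W y -> U (g y) /\ f (g y) = y)].

Definition diffeo_germ {V : normedModType R} (p : V) (f : V -> V) : Prop :=
  exists g, diffeo_germ_with p f g.

Definition A_equiv0 (g1 g2 : R -> 'rV[R]_2) : Prop :=
  exists (psi psiinv : R -> R) (Psi : 'rV[R]_2 -> 'rV[R]_2),
    [/\ diffeo_germ_with (0 : R) psi psiinv, psi 0 = 0,
        diffeo_germ (g1 0) Psi &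
        \forall s \near (0 : R), Psi (g1 (psiinv s)) = g2 s].

Definition cusp45 (t : R) : 'rV[R]_2 :=
  \row_(i < 2) (if val i == 0%N then t ^+ 4 else t ^+ 5).

End Defs.

(* Main.v *)
(** If [gam] is equivalent to the cusp, then [gam = G o cusp o psi] near 0. The cusp has order 4, so
the jet of order 7 of [gam] at 0 only involves the differential of [G] and the jet of order 4 of
[psi]; in terms of these data the relation between [A], [B], [C], [D] is a polynomial identity.

Conversely, the relation is what is needed to find a polynomial reparametrisation [th] such that
neither coordinate of [gam o th] has a term in [t^6], [t^7] or [t^11]. These exponents, with 1, 2, 3,
are the gaps of the semigroup generated by 4 and 5, and a smooth function without such terms is a
smooth function of [(t^4, t^5)]. Hence [gam o th = F o cusp] with [F] smooth; [A != 0] makes [F] a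
local diffeomorphism, and its inverse is the required change of coordinates. *)

Require Import Defs.
From HB Require Import structures.
From mathcomp Require Import all_boot all_order all_algebra.
From mathcomp Require Import all_classical all_reals all_analysis.
From mathcomp Require Import ring lra zify.
Import Order.TTheory GRing.Theory Num.Theory.
Import numFieldNormedType.Exports.
Local Open Scope classical_set_scope.
Local Open Scope ring_scope.
Set Implicit Arguments. Unset Strict Implicit. Unset Printing Implicit Defensive.

(** * Functions of class C^k *)

Section Ck.
Variable R : realType.
Implicit Types V : normedModType R.

Section Def.
Variable V : normedModType R.

(** The relation comes from counting equations. On the 7-jet, a reparametrisation tangent to the
    identity acts through three parameters, the coefficients of [t^2], [t^3], [t^4], whereas
    removing [t^6] and [t^7] from two coordinates imposes four equations. In the basis formed by the
    coefficient vectors of [t^4] and [t^5], independent because [A != 0], three equations determine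
    the parameters and the fourth is the relation; in Taylor coefficients its constants are -22, 25,
    20. The gap 11 costs no condition: adding terms in [t^7] and [t^8] to [t] gives two parameters
    for two equations. The analytic obstacle is that a Taylor series leaves a flat remainder
    undetermined, and this remainder must factor through the cusp as well. It does so as a function
    of [t = y^(1/5)], flatness absorbing the negative powers of [t] that differentiation creates.
    Scalar functions of class [Ck], with differentials, replace the directional derivatives of
    [smooth_on] because the chain rule needs differentials. *)

Fixpoint Ck (k : nat) (U : set V) (f : V -> R) : Prop :=
  match k with
  | 0 => forall x, U x -> {for x, continuous f}
  | k'.+1 => (forall x, U x -> differentiable f x) /\
             (forall v, Ck k' U (fun x => 'D_v f x))
  end.

Definition smooth (U : set V) (f : V -> R) := forall k, Ck k U f.

End Def.

Lemma Ck_cont V k (U : set V) f : Ck k U f -> forall x, U x -> {for x, continuous f}.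
Proof.
case: k => [//|k] [df _] x Ux; exact/differentiable_continuous/df.
Qed.

Lemma CkW V k (U : set V) f : Ck k.+1 U f -> Ck k U f.
Proof.
elim: k f => [|k IH] f; first exact: Ck_cont.
by move=> [df Df]; split=> // v; apply: IH.
Qed.

Lemma CkS V k (U U' : set V) f : U' `<=` U -> Ck k U f -> Ck k U' f.
Proof.
move=> sU; elim: k f => [|k IH] f /=; first by move=> cf x /sU /cf.
by move=> [df Df]; split=> [x /sU /df //|v]; apply: IH.
Qed.

Lemma near_open V (U : set V) (P : V -> Prop) : open U ->
  (forall x, U x -> P x) -> forall x, U x -> \forall y \near x, P y.
Proof.
move=> oU H x Ux; apply: filterS (open_nbhs_nbhs (conj oU Ux)) => y; exact: H.
Qed.

Lemma differentiable_eps V (W : normedModType R) (f : V -> W) x (L : {linear V -> W}) :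
  continuous L ->
  (forall e : R, 0 < e -> \forall h \near 0, `|f (h + x) - (f x + L h)| <= e * `|h|) ->
  differentiable f x /\ 'd f x = L :> (V -> W).
Proof.
move=> cL H.
have E : f \o shift x = cst (f x) + (L : V -> W) +o_ (0:V) id.
  by apply: eqaddoE; apply/eqaddoP => e e0; apply: filterS (H e e0) => h.
have D := diff_unique cL E; split => //.
by apply/diff_locallyP; rewrite D.
Qed.

Lemma diff_eps V (W : normedModType R) (f : V -> W) x : differentiable f x ->
  forall e : R, 0 < e -> \forall h \near 0, `|f (h + x) - (f x + 'd f x h)| <= e * `|h|.
Proof.
move=> /diff_locally /eqaddoP H e e0; have := H e e0.
by apply: filterS => h.
Qed.

Lemma differentiable_near V (W : normedModType R) (f g : V -> W) x :
  (\forall y \near x, f y = g y) -> differentiable f x -> differentiable g x.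
Proof.
move=> fg df.
have fgx : f x = g x by exact: nbhs_singleton fg.
suff [] : differentiable g x /\ 'd g x = 'd f x :> (V -> W) by [].
apply: differentiable_eps; first exact: diff_continuous.
move=> e e0; have H := diff_eps df e0.
have fg' : \forall h \near (0 : V), f (h + x) = g (h + x).
  move: (fg); rewrite (near_shift 0 x) subr0 => H0.
  exact: H0.
near=> h; rewrite -fgx; have <- : f (h + x) = g (h + x) by near: h.
  by near: h.
Unshelve. all: by end_near. Qed.

(** Openness of [U] turns equality on [U] into equality near each of its points, so directional
    derivatives agree as well. The closure rules below use this to replace a derivative by its
    formula on [U] only. *)
Lemma Ck_eq V k (U : set V) f g : open U -> (forall x, U x -> f x = g x) ->
  Ck k U f -> Ck k U g.
Proof.
move=> oU; elim: k f g => [|k IH] f g fg /=.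
  move=> cf x Ux; have cfx : f y @[y --> x] --> f x := cf _ Ux.
  change (g y @[y --> x] --> g x); rewrite -(fg _ Ux); apply: cvg_trans cfx.
  by apply: near_eq_cvg; apply: (near_open oU) x Ux => y /fg.
have nfg := near_open oU fg.
move=> [df Df]; split=> [x Ux|v]; first exact: differentiable_near (nfg _ Ux) (df _ Ux).
by apply: IH (Df v) => x Ux; apply: near_eq_derive; exact: nfg.
Qed.

Lemma Ck_cst V k (U : set V) (c : R) : Ck k U (fun=> c).
Proof.
elim: k c => [|k IH] c /=; first by move=> x _; exact: cst_continuous.
split=> [x _|v]; first exact: differentiable_cst.
have -> : (fun x : V => 'D_v (fun=> c) x) = (fun=> 0) by apply/funext => x; exact: derive_cst.
exact: IH.
Qed.

Lemma CkD V k (U : set V) f g : open U ->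
  Ck k U f -> Ck k U g -> Ck k U (fun x => f x + g x).
Proof.
move=> oU; elim: k f g => [|k IH] f g /=.
  by move=> cf cg x Ux; apply: continuousD; [exact: cf|exact: cg].
move=> [df Df] [dg Dg]; split=> [x Ux|v].
  by apply: differentiableD; [exact: df|exact: dg].
apply: Ck_eq (IH _ _ (Df v) (Dg v)) => // x Ux.
by rewrite -deriveD //; apply: diff_derivable; [exact: df|exact: dg].
Qed.

Lemma CkM V k (U : set V) f g : open U ->
  Ck k U f -> Ck k U g -> Ck k U (fun x => f x * g x).
Proof.
move=> oU; elim: k f g => [|k IH] f g.
  by move=> cf cg x Ux; apply: continuousM; [exact: cf|exact: cg].
move=> Cf Cg; case: (Cf) (Cg) => df Df [dg Dg]; split=> [x Ux|v].
  by apply: differentiableM; [exact: df|exact: dg].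
apply: Ck_eq (CkD oU (IH _ _ (CkW Cf) (Dg v)) (IH _ _ (CkW Cg) (Df v))) => // x Ux.
by transitivity ('D_v (f * g) x) => //; rewrite deriveM //; apply: diff_derivable;
  [exact: df|exact: dg].
Qed.

Lemma CkZ V k (U : set V) (c : R) f : open U -> Ck k U f -> Ck k U (fun x => c * f x).
Proof. by move=> oU; apply: CkM => //; exact: Ck_cst. Qed.

Lemma CkN V k (U : set V) f : open U -> Ck k U f -> Ck k U (fun x => - f x).
Proof.
by move=> oU /(CkZ (-1) oU); apply: Ck_eq => // x _; rewrite mulN1r.
Qed.

Lemma CkB V k (U : set V) f g : open U ->
  Ck k U f -> Ck k U g -> Ck k U (fun x => f x - g x).
Proof. by move=> oU Cf Cg; apply: CkD => //; exact: CkN. Qed.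

Lemma CkX V k (U : set V) f n : open U -> Ck k U f -> Ck k U (fun x => f x ^+ n).
Proof.
move=> oU Cf; elim: n => [|n IH]; first exact: Ck_cst.
by apply: Ck_eq (CkM oU Cf IH) => // x _; rewrite exprS.
Qed.

Lemma Ck_sum V k (U : set V) I (r : seq I) (f : I -> V -> R) : open U ->
  (forall i, Ck k U (f i)) -> Ck k U (fun x => \sum_(i <- r) f i x).
Proof.
move=> oU Cf; elim: r => [|i r IH].
  by apply: Ck_eq (Ck_cst k U 0) => // x _; rewrite big_nil.
by apply: Ck_eq (CkD oU (Cf i) IH) => // x _; rewrite big_cons.
Qed.

Lemma CkV V k (U : set V) f : open U -> (forall x, U x -> f x != 0) ->
  Ck k U f -> Ck k U (fun x => (f x)^-1).
Proof.
move=> oU f0; elim: k => [|k IH].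
  by move=> cf x Ux; apply: continuousV; [exact: f0|exact: cf].
move=> Cf; case: (Cf) => df Df; split=> [x Ux|v].
  by apply: differentiableV; [exact: df|exact: f0].
have CV := IH (CkW Cf).
apply: Ck_eq (CkN oU (CkM oU (CkM oU CV CV) (Df v))) => // x Ux.
have dvf : derivable f x v by apply: diff_derivable; exact: df.
by rewrite (deriveV (f0 _ Ux) dvf) scaleNr expr2 invfM.
Qed.

Lemma Ck_comp1 V k (U : set V) (U' : set R) (f : R -> R) (u : V -> R) :
  open U -> (forall x, U x -> U' (u x)) -> Ck k U' f -> Ck k U u ->
  Ck k U (fun x => f (u x)).
Proof.
move=> oU sU; elim: k f => [|k IH] f.
  by move=> cf cu x Ux; apply: continuous_comp; [exact: cu|exact/cf/sU].
move=> Cf Cu; case: (Cf) (Cu) => df Df [du Du]; split=> [x Ux|v].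
  by apply: differentiable_comp; [exact: du|exact/df/sU].
apply: Ck_eq (CkM oU (IH _ (Df 1) (CkW Cu)) (Du v)) => // x Ux.
have dfx := df _ (sU _ Ux); have dux := du _ Ux.
have dfu : differentiable (f \o u) x by exact: differentiable_comp.
have E : 'D_v (fun x => f (u x)) x = 'd f (u x) ('d u x v).
  exact: etrans (deriveE v dfu) (congr1 (fun F : V -> R => F v) (diff_comp dux dfx)).
rewrite E (deriveE v dux) (deriveE (1 : R) dfx).
by rewrite mulrC -[LHS]/('d u x v *: 'd f (u x) (1 : R)) -linearZ /= [_ *: 1]mulr1.
Qed.

(** Built with the same row expression as [cusp45], so that [cusp45 t] is convertible to
    [pt (t ^+ 4) (t ^+ 5)]. *)
Definition pt (a b : R) : 'rV[R]_2 := \row_(i < 2) (if val i == 0%N then a else b).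

Lemma pt0 a b : pt a b 0 0 = a. Proof. by rewrite mxE. Qed.
Lemma pt1 a b : pt a b 0 1 = b. Proof. by rewrite mxE. Qed.

Lemma ptK (p : 'rV[R]_2) : pt (p 0 0) (p 0 1) = p.
Proof.
apply/rowP => i; rewrite mxE; case: i => -[|[|//]] Hi /=; congr (p _ _); exact/val_inj.
Qed.

Lemma pt_lin a b : pt a b = a *: pt 1 0 + b *: pt 0 1.
Proof.
apply/rowP => i; rewrite !mxE; case: (val i == 0%N).
  by rewrite mulr1 mulr0 addr0.
by rewrite mulr1 mulr0 add0r.
Qed.

Lemma diff_pt V (u v : V -> R) x : differentiable u x -> differentiable v x ->
  differentiable (fun x => pt (u x) (v x)) x /\
  forall w, 'd (fun x => pt (u x) (v x)) x w = pt ('d u x w) ('d v x w).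
Proof.
move=> du dv.
have -> : (fun x => pt (u x) (v x)) =
    (fun x => u x *: pt 1 0) + (fun x => v x *: pt 0 1).
  by apply/funext => y; rewrite pt_lin.
have d1 := @differentiableZl _ _ _ _ (pt 1 0) _ du.
have d2 := @differentiableZl _ _ _ _ (pt 0 1) _ dv.
split; first exact: differentiableD.
move=> w; rewrite [RHS]pt_lin (diffD d1 d2).
transitivity ('d (fun x => u x *: pt 1 0) x w + 'd (fun x => v x *: pt 0 1) x w) => //.
congr (_ + _).
  exact: (congr1 (fun F : V -> 'rV[R]_2 => F w) (diffZl (pt 1 0) du)).
exact: (congr1 (fun F : V -> 'rV[R]_2 => F w) (diffZl (pt 0 1) dv)).
Qed.

Lemma Ck_comp2 V k (U : set V) (U' : set 'rV[R]_2) (f : 'rV[R]_2 -> R) (u v : V -> R) :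
  open U -> (forall x, U x -> U' (pt (u x) (v x))) -> Ck k U' f ->
  Ck k U u -> Ck k U v -> Ck k U (fun x => f (pt (u x) (v x))).
Proof.
move=> oU sU; elim: k f => [|k IH] f.
  move=> cf cu cv x Ux; apply: (@continuous_comp _ _ _ (fun x => pt (u x) (v x))).
    have -> : (fun x => pt (u x) (v x)) =
      (fun x => u x *: pt 1 0 + v x *: pt 0 1) by apply/funext => y; rewrite pt_lin.
    by apply: continuousD; apply: cvgZr_tmp; [exact: cu|exact: cv].
  exact/cf/sU.
move=> Cf Cu Cv; case: (Cf) (Cu) (Cv) => df Df [du Du] [dv Dv]; split=> [x Ux|w].
  have [dp _] := diff_pt (du _ Ux) (dv _ Ux).
  by apply: (@differentiable_comp _ _ _ _ (fun x => pt (u x) (v x)) f) => //; exact/df/sU.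
have H1 := CkM oU (IH _ (Df (pt 1 0)) (CkW Cu) (CkW Cv)) (Du w).
have H2 := CkM oU (IH _ (Df (pt 0 1)) (CkW Cu) (CkW Cv)) (Dv w).
apply: Ck_eq (CkD oU H1 H2) => // x Ux.
have dfx := df _ (sU _ Ux); have dux := du _ Ux; have dvx := dv _ Ux.
have [dp Edp] := diff_pt dux dvx.
have dfp : differentiable (f \o (fun x => pt (u x) (v x))) x by exact: differentiable_comp.
rewrite (deriveE w dux) (deriveE w dvx) (deriveE (pt 1 0) dfx) (deriveE (pt 0 1) dfx).
have E : 'D_w (fun x => f (pt (u x) (v x))) x =
    'd f (pt (u x) (v x)) ('d (fun x => pt (u x) (v x)) x w).
  exact: etrans (deriveE w dfp) (congr1 (fun F : V -> R => F w) (diff_comp dp dfx)).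
by rewrite E Edp (pt_lin ('d u x w)) linearD !linearZ /= mulrC [X in _ + X]mulrC.
Qed.

End Ck.
Arguments Ck {R V} k U f.
Arguments smooth {R V} U f.

(** * Taylor expansions at 0 *)

Section Taylor.
Variable R : realType.
Implicit Types (f g : R -> R) (U : set R) (p q : {poly R}).

Fixpoint dn (n : nat) f : R -> R :=
  if n is n'.+1 then fun x => 'D_1 (dn n' f) x else f.

Lemma dnS n f x : dn n.+1 f x = 'D_1 (dn n f) x. Proof. by []. Qed.

Lemma dnSr n f : dn n.+1 f = dn n (fun x => 'D_1 f x).
Proof. by elim: n => [//|n IH]; apply/funext => x; rewrite dnS IH -dnS. Qed.

Lemma smooth_dn U f n : smooth U f -> smooth U (dn n f).
Proof. by move=> sf; elim: n => [//|n IH] k; have [_] := IH k.+1; apply. Qed.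

Lemma smooth_derive U f : smooth U f -> smooth U (fun x => 'D_1 f x).
Proof. exact: (@smooth_dn U f 1). Qed.

Lemma smooth_is_derive U f x : smooth U f -> U x -> is_derive x 1 f ('D_1 f x).
Proof. by move=> sf Ux; apply/derivableP/diff_derivable; have [d _] := sf 1%N; exact: d. Qed.

Lemma is_derive_differentiable f (x a : R) : is_derive x 1 f a -> differentiable f x.
Proof. by move=> h; apply/derivable1_diffP; apply: ex_derive. Qed.

Lemma Ck_of_derive U f f' k : open U -> (forall x, U x -> is_derive x 1 f (f' x)) ->
  Ck k U f' -> Ck k.+1 U f.
Proof.
move=> oU df Cf'; split=> [x Ux|v]; first exact: is_derive_differentiable (df _ Ux).
apply: Ck_eq (CkZ v oU Cf') => // x Ux.
have h := df _ Ux; have dfx := is_derive_differentiable h.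
have <- : 'D_1 f x = f' x by rewrite derive_val.
rewrite (deriveE v dfx) (deriveE (1 : R) dfx) -[LHS]/(v *: 'd f x (1 : R)) -linearZ /=.
by rewrite [_ *: 1]mulr1.
Qed.

(** This is how smoothness is obtained for functions whose successive derivatives are all guessed in
    advance: the flat exponential and the Borel sum. *)
Lemma smooth_seq U (F : nat -> R -> R) : open U ->
  (forall n x, U x -> is_derive x 1 (F n) (F n.+1 x)) -> forall n, smooth U (F n).
Proof.
move=> oU dF n k; elim: k n => [|k IH] n.
  move=> x Ux; exact/differentiable_continuous/is_derive_differentiable/(dF n x Ux).
exact: Ck_of_derive (dF n) (IH n.+1).
Qed.

(** The mean value theorem replaces integration here: a bound of order [n] on the derivative becomes
    one of order [n + 1] on the increment from 0. *)
Lemma mvt_pow f f1 (e M : R) (n : nat) :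
  (forall x : R, `|x| < e -> is_derive x 1 f (f1 x)) ->
  (forall x : R, `|x| < e -> `|f1 x| <= M * `|x| ^+ n) ->
  forall x : R, `|x| < e -> `|f x - f 0| <= M * `|x| ^+ n.+1.
Proof.
move=> df bf x xe.
have H (c : R) : `|c| <= `|x| -> `|f1 c * x| <= M * `|x| ^+ n.+1.
  move=> cx; rewrite normrM exprSr mulrA; apply: ler_wpM2r => //.
  have ce := le_lt_trans cx xe; have fc := bf _ ce.
  have [n0|n0] := posnP n; first by move: fc; rewrite n0 !expr0.
  (* Monotonicity in [|c| <= |x|] needs the sign of [M]. For [c != 0] it follows from the bound at
     [c]; for [c = 0] the left side is bounded by 0 and the bound at [x] gives the sign of the right
     side. *)
  have [->|c0] := eqVneq c 0.
    apply: (le_trans (bf 0 _)); first by rewrite normr0 (le_lt_trans _ xe).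
    have [->|x0] := eqVneq x 0; first by [].
    rewrite normr0 expr0n gtn_eqF // mulr0.
    have : 0 <= M * `|x| ^+ n := le_trans (normr_ge0 _) (bf x xe).
    by [].
  apply: (le_trans fc); apply: ler_wpM2l; last exact: lerXn2r.
  have : 0 <= M * `|c| ^+ n := le_trans (normr_ge0 _) fc.
  by rewrite pmulr_lge0 // exprn_gt0 // normr_gt0.
have cont (a b : R) : `|a| < e -> `|b| < e -> {within `[a, b], continuous f}.
  move=> ae be; apply: continuous_in_subspaceT => y; rewrite inE /= in_itv /= => /andP[ay yb].
  apply/differentiable_continuous/is_derive_differentiable/df.
  by move: ae be; rewrite !ltr_norml => /andP[? ?] /andP[? ?]; apply/andP; split; lra.
have e0 : `|0 : R| < e by rewrite normr0 (le_lt_trans _ xe).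
have dfi (a b : R) : `|a| < e -> `|b| < e -> forall y, y \in `]a, b[ -> is_derive y 1 f (f1 y).
  move=> ae be y; rewrite in_itv /= => /andP[ay yb]; apply: df.
  by move: ae be; rewrite !ltr_norml => /andP[? ?] /andP[? ?]; apply/andP; split; lra.
have [x0|x0|->] := ltgtP x 0.
- have [c] := MVT x0 (dfi _ _ xe e0) (cont _ _ xe e0).
  rewrite in_itv /= => /andP[xc c0] E.
  have -> : f x - f 0 = f1 c * x by rewrite -[LHS]opprB E; ring.
  by apply: H; rewrite !ltr0_norm //; lra.
- have [c] := MVT x0 (dfi _ _ e0 xe) (cont _ _ e0 xe).
  rewrite in_itv /= => /andP[xc c0] E.
  have -> : f x - f 0 = f1 c * x by rewrite E; ring.
  by apply: H; rewrite !gtr0_norm //; lra.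
- by rewrite subrr normr0 expr0n /= mulr0.
Qed.

(* [f = O(t^n)] as [t] tends to 0. *)
Definition Ot (n : nat) f := exists C, \forall t \near (0 : R), `|f t| <= C * `|t| ^+ n.

Lemma near0_lt (e : R) : 0 < e -> \forall t \near (0 : R), `|t| < e.
Proof.
move=> e0; apply/nbhs_ballP; exists e => //= t.
by rewrite -ball_normE /= sub0r normrN.
Qed.

Lemma near0_ball (P : R -> Prop) : (\forall t \near (0 : R), P t) ->
  exists2 e, 0 < e & forall t, `|t| < e -> P t.
Proof.
move=> /nbhs_ballP [e /= e0 H]; exists e => // t te; apply: H.
by rewrite -ball_normE /ball_ /= sub0r normrN.
Qed.

Lemma Ot_eq n f g : (\forall t \near (0 : R), f t = g t) -> Ot n f -> Ot n g.
Proof.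
move=> fg [C H]; exists C; near=> t; have <- : f t = g t by near: t.
by near: t.
Unshelve. all: by end_near. Qed.

Lemma OtD n f g : Ot n f -> Ot n g -> Ot n (fun t => f t + g t).
Proof.
move=> [C Cf] [D Dg]; exists (C + D); near=> t.
by rewrite mulrDl (le_trans (ler_normD _ _)) // lerD //; near: t.
Unshelve. all: by end_near. Qed.

Lemma OtM n m f g : Ot n f -> Ot m g -> Ot (n + m) (fun t => f t * g t).
Proof.
move=> [C Cf] [D Dg]; exists (C * D); near=> t.
by rewrite normrM exprD mulrACA ler_pM //; near: t.
Unshelve. all: by end_near. Qed.

Lemma OtW n m f : (m <= n)%N -> Ot n f -> Ot m f.
Proof.
move=> mn [C Cf]; exists `|C|; near=> t.
have t1 : `|t| < 1 by near: t; apply: near0_lt.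
have H : `|f t| <= C * `|t| ^+ n by near: t.
apply: (le_trans H); apply: (le_trans (ler_wpM2r _ (ler_norm C))); first exact: exprn_ge0.
by apply: ler_wpM2l => //; apply: ler_wiXn2l => //; exact: ltW.
Unshelve. all: by end_near. Qed.

Lemma Ot_cont f : {for 0, continuous f} -> Ot 0 f.
Proof.
move=> cf; exists (`|f 0| + 1).
have : \forall t \near (0 : R), `|f 0 - f t| < 1.
  by have := cf => /cvgrPdist_lt /(_ 1 ltr01).
apply: filterS => t H; rewrite expr0 mulr1.
have -> : f t = f 0 - (f 0 - f t) by ring.
by apply: (le_trans (ler_normB _ _)); rewrite lerD2l ltW.
Qed.

Lemma Ot_X n : Ot n (fun t => t ^+ n).
Proof. by exists 1; near=> t; rewrite mul1r normrX.
Unshelve. all: by end_near. Qed.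

Lemma Ot_horner p : Ot 0 (horner p).
Proof. exact/Ot_cont/continuous_horner. Qed.

Lemma OtN n f : Ot n f -> Ot n (fun t => - f t).
Proof. by move=> [C H]; exists C; apply: filterS H => t; rewrite normrN. Qed.

Lemma Ot_comp n f g : Ot n f -> Ot 1 g -> Ot n (fun t => f (g t)).
Proof.
move=> [C Cf] [D Dg]; have [e e0 He] := near0_ball Cf.
pose M := `|D| + 1; have M0 : 0 < M by rewrite /M ltr_wpDl.
exists (`|C| * M ^+ n); near=> t.
have t1 : `|t| < e / M by near: t; apply: near0_lt; rewrite divr_gt0.
have gt : `|g t| <= M * `|t|.
  have H : `|g t| <= D * `|t| ^+ 1 by near: t.
  apply: (le_trans H); rewrite expr1; apply: ler_wpM2r => //.
  by rewrite (le_trans (ler_norm _)) // lerDl.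
have ge : `|g t| < e by apply: (le_lt_trans gt); rewrite mulrC -ltr_pdivlMr.
apply: (le_trans (He _ ge)); apply: (le_trans (ler_wpM2r _ (ler_norm C))).
  exact: exprn_ge0.
by rewrite -mulrA -exprMn; apply: ler_wpM2l => //; apply: lerXn2r => //;
  rewrite nnegrE ?mulr_ge0 // ltW.
Unshelve. all: by end_near. Qed.

(** Excluding [t = 0] from the bound lets the induction divide by [t]: once [p.[0] = 0], the
    quotient of [p] by ['X] satisfies the bound of order one less. *)
Lemma Ot_poly0 n p :
  (exists C, \forall t \near (0 : R), t != 0 -> `|p.[t]| <= C * `|t| ^+ n) ->
  forall i, (i < n)%N -> p`_i = 0.
Proof.
elim: n p => [|n IH] p [C HC] // .
have p0 : p.[0] = 0.
  apply/eqP/contraT; rewrite -normr_gt0 => p0.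
  have /cvgrPdist_lt /(_ (`|p.[0]| / 2)) Hp : p.[t] @[t --> (0 : R)] --> p.[0].
    exact: continuous_horner.
  have {}Hp := Hp (divr_gt0 p0 (ltr0Sn _ _)).
  have [e e0 He] := near0_ball (filterI HC Hp).
  (* At this [t] both [|p.[t]|] and [|p.[0] - p.[t]|] are less than half of [|p.[0]|], which is
     absurd. *)
  pose t := Num.min (e / 2) (Num.min 1 (`|p.[0]| / (2 * (`|C| + 1)))).
  have C1 : 0 < `|C| + 1 by rewrite ltr_wpDl.
  have t0 : 0 < t by rewrite !lt_min ltr01 !divr_gt0 // mulr_gt0.
  have te : `|t| < e.
    rewrite gtr0_norm //; apply: (@le_lt_trans _ _ (e / 2)); first by rewrite ge_min lexx.
    by rewrite ltr_pdivrMr //; lra.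
  have t1 : t <= 1 by rewrite !ge_min lexx orbT.
  have t2 : t * (`|C| + 1) <= `|p.[0]| / 2.
    rewrite -ler_pdivlMr //; apply: (@le_trans _ _ (`|p.[0]| / (2 * (`|C| + 1)))).
      by rewrite !ge_min lexx !orbT.
    by rewrite invfM mulrA.
  have [H1 H2] := He _ te; have {}H1 := H1 (lt0r_neq0 t0).
  have H3 : C * `|t| ^+ n.+1 <= t * `|C|.
    apply: (le_trans (ler_wpM2r _ (ler_norm C))); first exact: exprn_ge0.
    rewrite mulrC; apply: ler_wpM2r => //; rewrite gtr0_norm // exprS ger_pMr //.
    by rewrite exprn_ile1 // ltW.
  have := ler_normD (p.[0] - p.[t]) p.[t]; rewrite subrK.
  by have := normr_ge0 C; nra.
have /factor_theorem [q Eq] : root p 0 by apply/rootP.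
move: Eq; rewrite subr0 => Eq.
case=> [|i] ilt; first by rewrite -horner_coef0.
rewrite Eq coefMX /=; apply: IH => //; exists C.
apply: filterS HC => t H t0; have := H t0; rewrite Eq hornerM hornerX normrM exprSr mulrA.
by rewrite ler_pM2r // normr_gt0.
Qed.

(** The degree of [p] is left free, so products and compositions of expansions need no truncation;
    [tayP] shows that the coefficients below [n] are determined. *)
Definition tay n f p := Ot n (fun t => f t - p.[t]).

Lemma tayP n f p q : tay n f p -> tay n f q -> forall i, (i < n)%N -> p`_i = q`_i.
Proof.
move=> Hp Hq i ilt; apply/eqP; rewrite -subr_eq0 -coefB; apply/eqP.
have := OtD Hq (OtN Hp) => -[C HC]; apply: (@Ot_poly0 n) => //; exists C.
apply: filterS HC => t H _; have -> : (p - q).[t] = f t - q.[t] + - (f t - p.[t]) => //.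
by rewrite hornerD hornerN; ring.
Qed.

Lemma tay_eq n f g p : (\forall t \near (0 : R), f t = g t) -> tay n f p -> tay n g p.
Proof. by move=> fg; apply: Ot_eq; apply: filterS fg => t ->. Qed.

Lemma tayD n f g p q : tay n f p -> tay n g q -> tay n (fun t => f t + g t) (p + q).
Proof.
by move=> Hf Hg; apply: Ot_eq (OtD Hf Hg); near=> t; rewrite hornerD; ring.
Unshelve. all: by end_near. Qed.

Lemma tay_Ot0 n f p : tay n f p -> Ot 0 f.
Proof.
move=> /(OtW (leq0n n)) Hf; apply: Ot_eq (OtD Hf (Ot_horner p)); near=> t.
by rewrite subrK.
Unshelve. all: by end_near. Qed.

Lemma tayM n f g p q : tay n f p -> tay n g q -> tay n (fun t => f t * g t) (p * q).
Proof.
move=> Hf Hg; have H1 := OtM (tay_Ot0 Hf) Hg; have H2 := OtM (Ot_horner q) Hf.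
apply: Ot_eq (OtD H1 H2); near=> t; rewrite hornerM; ring.
Unshelve. all: by end_near. Qed.

Lemma tay_poly n p : tay n (horner p) p.
Proof. by exists 0; near=> t; rewrite subrr normr0 mul0r.
Unshelve. all: by end_near. Qed.

Lemma tay_cst n c : tay n (fun=> c) c%:P.
Proof. by apply: tay_eq (tay_poly n c%:P); near=> t; rewrite hornerC.
Unshelve. all: by end_near. Qed.

Lemma tay_horner n g p q : tay n g q -> tay n (fun t => p.[g t]) (p \Po q).
Proof.
move=> Hg; elim/poly_ind: p => [|p c IH].
  by rewrite comp_poly0; apply: tay_eq (tay_cst n 0); near=> t; rewrite horner0.
rewrite comp_poly_MXaddC; apply: tay_eq (tayD (tayM IH Hg) (tay_cst n c)).
by near=> t; rewrite hornerMXaddC.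
Unshelve. all: by end_near. Qed.

Lemma tay_comp n f g p q : tay n f p -> tay n g q -> Ot 1 g ->
  tay n (fun t => f (g t)) (p \Po q).
Proof.
move=> Hf Hg g1; have H1 := Ot_comp Hf g1; have H2 := tay_horner p Hg.
by apply: Ot_eq (OtD H1 H2); near=> t; ring.
Unshelve. all: by end_near. Qed.

Definition tpoly n f : {poly R} := \poly_(i < n) (dn i f 0 / i`!%:R).

Lemma tpoly_derive n f : (tpoly n.+1 f)^`() = tpoly n (fun x => 'D_1 f x).
Proof.
apply/polyP => i; rewrite coef_deriv !coef_poly ltnS; case: ifP => _; last by rewrite mul0rn.
rewrite -mulr_natr dnSr factS natrM invfM; field.
by rewrite -!mulrS !pnatr_eq0 /= -lt0n fact_gt0.
Qed.

(** By [tpoly_derive] the derivative of the remainder is the remainder of the derivative. The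
    induction bounds the latter, and [mvt_pow] gains one order because the remainder vanishes at
    0. *)
Lemma taylor U f n : open U -> U 0 -> smooth U f -> tay n f (tpoly n f).
Proof.
move=> oU U0; elim: n f => [|n IH] f sf.
  have -> : tpoly 0 f = 0 by apply/polyP => i; rewrite coef_poly coef0.
  have : Ot 0 f by apply: Ot_cont; exact: Ck_cont (sf 0%N) _ U0.
  by apply: Ot_eq; near=> t; rewrite horner0 subr0.
have [C HC] := IH _ (smooth_derive sf).
have oU0 : \forall t \near (0 : R), U t by exact: open_nbhs_nbhs.
have [e e0 He] := near0_ball (filterI HC oU0).
exists C; near=> t; have te : `|t| < e by near: t; apply: near0_lt.
have t0 : f 0 - (tpoly n.+1 f).[0] = 0.
  by rewrite horner_coef0 coef_poly /= fact0 divr1 subrr.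
rewrite -[f t - _]subr0 -t0.
apply: (@mvt_pow (fun x => f x - (tpoly n.+1 f).[x])
  (fun x => 'D_1 f x - (tpoly n (fun x => 'D_1 f x)).[x]) e) => // x xe; last by have [] := He x xe.
have Ux : U x by have [] := He x xe.
have h1 := smooth_is_derive sf Ux; rewrite -tpoly_derive.
exact: (@is_deriveB _ _ _ f (horner (tpoly n.+1 f)) x 1).
Unshelve. all: by end_near. Qed.

Lemma tpoly_coef n f i : (i < n)%N -> (tpoly n f)`_i = dn i f 0 / i`!%:R.
Proof. by move=> H; rewrite coef_poly H. Qed.

(** Derivatives at 0 can thus be read off any expansion, however obtained; compositions are never
    differentiated by hand. *)
Lemma dn_tay U f n p i : open U -> U 0 -> smooth U f -> tay n f p -> (i < n)%N ->
  dn i f 0 = i`!%:R * p`_i.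
Proof.
move=> oU U0 sf Hp ilt; rewrite -(tayP (taylor n oU U0 sf) Hp ilt) tpoly_coef //.
by field; rewrite pnatr_eq0 -lt0n fact_gt0.
Qed.

End Taylor.

(** * A smooth cutoff function *)

Section Cutoff.
Variable R : realType.
Implicit Types (f g : R -> R) (U : set R) (p q : {poly R}).

Lemma is_derive_Ot2 f : Ot 2 f -> is_derive (0 : R) 1 f 0.
Proof.
move=> [C HC]; have f0 : f 0 = 0.
  have := nbhs_singleton HC; rewrite normr0 expr0n /= mulr0 => H.
  by apply/eqP; rewrite -normr_le0.
(* With [0^-1 = 0] this slope takes at 0 the value 0, which is the derivative wanted. *)
apply/is_derive1_caratheodory; exists (fun z => f z / z); split.
- move=> z; rewrite f0 !subr0; have [->|z0] := eqVneq z 0; first by rewrite f0 mulr0.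
  by rewrite divfK.
- change (f z / z @[z --> (0 : R)] --> f 0 / 0).
  rewrite f0 mul0r; apply/cvgrPdist_lt => e e0; near=> z.
  rewrite sub0r normrN; have [->|z0] := eqVneq z 0; first by rewrite f0 mul0r normr0.
  have z1 : 0 < `|z| by rewrite normr_gt0.
  have C1 : 0 < `|C| + 1 by rewrite ltr_wpDl.
  have H : `|f z| <= C * `|z| ^+ 2 by near: z.
  rewrite normrM normfV ltr_pdivrMr //; apply: (le_lt_trans H).
  rewrite expr2 mulrA ltr_pM2r //.
  have ze : `|z| < e / (`|C| + 1) by near: z; apply: near0_lt; rewrite divr_gt0.
  rewrite ltr_pdivlMr // in ze; apply: le_lt_trans ze.
  by rewrite mulrC ler_wpM2l // (le_trans (ler_norm C)) // lerDl.
- by rewrite f0 mul0r.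
Unshelve. all: by end_near. Qed.

Lemma is_derive_near f g (x d : R) : (\forall y \near x, f y = g y) ->
  is_derive x 1 f d -> is_derive x 1 g d.
Proof. exact: near_eq_is_derive. Qed.

(** With [u = 1/x], the derivative in [x] of [p(u) exp(-u)] is [u^2 (p(u) - p'(u)) exp(-u)], whence
    the recursion. *)
Definition epoly n : {poly R} := iter n (fun p => 'X ^+ 2 * (p - p^`())) 1.

(* The n-th derivative of the extension by 0 of [exp (- 1 / x)]. *)
Definition eflat n (x : R) : R := if 0 < x then (epoly n).[x^-1] * expR (- x^-1) else 0.

Lemma near_gt0 (x : R) : 0 < x -> \forall y \near x, 0 < y.
Proof. by move=> x0; apply: open_nbhs_nbhs; split => //; exact: open_gt. Qed.

Lemma near_lt0 (x : R) : x < 0 -> \forall y \near x, y < 0.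
Proof. by move=> x0; apply: open_nbhs_nbhs; split => //; exact: open_lt. Qed.

(** The exponential dominates [u^(n+2) / (n+2)!]. The decay [u^-2] is what gives every [eflat n]
    order 2 at 0, hence derivative 0 there. *)
Lemma poly_exp_bound p : exists C, forall u : R, 1 <= u -> `|p.[u]| * expR (- u) <= C * u ^- 2.
Proof.
have expb n : forall u : R, 1 <= u -> u ^+ n * expR (- u) <= n.+2`!%:R * u ^- 2.
  move=> u u1; have u0 : 0 < u by lra.
  rewrite expRN ler_pdivrMr ?expR_gt0 // mulrAC ler_pdivlMr ?exprn_gt0 //.
  rewrite -exprD addn2 mulrC -ler_pdivrMr ?ltr0n ?fact_gt0 //.
  by apply: le_trans (expR_ge1Dxn n.+1 (ltW u0)); rewrite lerDr.
elim/poly_ind: p => [|p c [C HC]].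
  by exists 0 => u _; rewrite horner0 normr0 !mul0r.
have [D HD] : exists D, forall u : R, 1 <= u -> `|(p * 'X).[u]| * expR (- u) <= D * u ^- 2.
  exists (\sum_(i < size (p * 'X)) `|(p * 'X)`_i| * i.+2`!%:R) => u u1.
  rewrite horner_coef (le_trans (ler_wpM2r (expR_ge0 _) (ler_norm_sum _ _ _))) //.
  rewrite !mulr_suml; apply: ler_sum => i _; rewrite normrM -!mulrA ler_wpM2l //.
  by rewrite ger0_norm ?exprn_ge0 ?expb // (le_trans _ u1).
exists (D + `|c| * 2) => u u1; rewrite hornerD hornerC.
rewrite (le_trans (ler_wpM2r (expR_ge0 _) (ler_normD _ _))) // !mulrDl lerD // ?HD //.
rewrite -mulrA ler_wpM2l //; have := expb 0%N u u1; rewrite expr0 mul1r.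
by [].
Qed.

Lemma eflat_Ot2 n : Ot 2 (eflat n).
Proof.
have [C HC] := poly_exp_bound (epoly n); exists `|C|; near=> t.
rewrite /eflat; case: ifPn => [t0|_]; last by rewrite normr0 mulr_ge0 // exprn_ge0.
have t1 : `|t| < 1 by near: t; exact: near0_lt.
rewrite gtr0_norm // in t1.
rewrite normrM (gtr0_norm (expR_gt0 _)) (gtr0_norm t0).
apply: (le_trans (HC _ _)); first by rewrite invf_ge1 // ltW.
by rewrite -exprVn invrK ler_wpM2r ?ler_norm // exprn_ge0 // ltW.
Unshelve. all: by end_near. Qed.

Lemma is_derive_comp1 f g (x a b : R) : is_derive x 1 f a -> is_derive (f x) 1 g b ->
  is_derive x 1 (fun y => g (f y)) (b * a).
Proof.
by move=> hf hg; exact: (@is_derive1_comp _ g f).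
Qed.

Lemma is_derive_eflat n (x : R) : is_derive x 1 (eflat n) (eflat n.+1 x).
Proof.
have [x0|x0|->] := ltgtP x 0.
- have -> : eflat n.+1 x = 0 by rewrite /eflat ltNge ltW.
  apply: (@is_derive_near (fun=> 0) _ x 0 _ (@is_derive_cst R R^o R^o 0 x 1)).
  by apply: filterS (near_lt0 x0) => y y0; rewrite /eflat ltNge ltW.
- apply: (@is_derive_near (fun y => (epoly n).[y^-1] * expR (- y^-1))).
    by apply: filterS (near_gt0 x0) => y y0; rewrite /eflat y0.
  have x1 : x != 0 by rewrite gt_eqF.
  have dV : is_derive x 1 (fun y : R => y^-1) (- x ^- 2).
    by have := @is_deriveV _ id x 1 1 x1 _; rewrite /GRing.scale /= mulr1; apply; exact: is_derive_id.
  have d1 := is_derive_comp1 dV (is_derive_poly (epoly n) x^-1).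
  have d2 := is_derive_comp1 (is_deriveN dV) (is_derive_expR (- x^-1)).
  apply: is_derive_eq (is_deriveM d1 d2) _.
  rewrite /eflat x0 /= !hornerE /GRing.scale /= expr2 invfM; ring.
- have -> : eflat n.+1 0 = 0 by rewrite /eflat ltxx.
  exact: is_derive_Ot2 (eflat_Ot2 n).
Qed.

Lemma smooth_eflat n : smooth setT (eflat n).
Proof. by apply: smooth_seq => [|k x _]; [exact: openT|exact: is_derive_eflat]. Qed.

Lemma eflat_gt0 (x : R) : 0 < x -> 0 < eflat 0 x.
Proof. by move=> x0; rewrite /eflat x0 hornerC mul1r expR_gt0. Qed.

Lemma eflat_le0 (x : R) : x <= 0 -> eflat 0 x = 0.
Proof. by rewrite /eflat ltNge => ->. Qed.

Lemma eflat_ge0 (x : R) : 0 <= eflat 0 x.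
Proof.
by have [x0|x0] := ltP 0 x; [rewrite ltW // eflat_gt0|rewrite eflat_le0].
Qed.

(** The usual quotient for a bump function. Using [u^2] instead of [|u|] keeps the argument smooth
    at 0; the support lies in [|u| <= sqrt 2]. *)
Definition cutoff (u : R) : R := eflat 0 (2 - u ^+ 2) / (eflat 0 (2 - u ^+ 2) + eflat 0 (u ^+ 2 - 1)).

Lemma cutoff_den (u : R) : eflat 0 (2 - u ^+ 2) + eflat 0 (u ^+ 2 - 1) != 0.
Proof.
have [u1|u1] := ltP (u ^+ 2) 2.
  by rewrite gt_eqF // ltr_pwDl ?eflat_ge0 // eflat_gt0 // subr_gt0.
by rewrite gt_eqF // ltr_wpDl ?eflat_ge0 // eflat_gt0 //; lra.
Qed.

Lemma cutoff1 (u : R) : u ^+ 2 <= 1 -> cutoff u = 1.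
Proof.
move=> u1; have := cutoff_den u; rewrite /cutoff (@eflat_le0 (u ^+ 2 - 1)) ?subr_le0 // addr0.
exact: divff.
Qed.

Lemma cutoff0 (u : R) : 2 <= u ^+ 2 -> cutoff u = 0.
Proof. by move=> u1; rewrite /cutoff eflat_le0 ?subr_le0 // mul0r. Qed.

Lemma Ck_id k U : Ck k U (fun x : R => x).
Proof.
case: k => [x _|k]; first exact: cvg_id.
split=> [x _|v]; first by apply/derivable1_diffP; exact: derivable_id.
have -> : (fun x : R => 'D_v (fun x : R => x) x) = (fun=> v).
  by apply/funext => x; exact: derive_id.
exact: Ck_cst.
Qed.

Lemma smooth_cutoff : smooth setT cutoff.
Proof.
move=> k; have oT := @openT R.
have C1 : Ck k setT (fun u : R => eflat 0 (2 - u ^+ 2)).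
  apply: (@Ck_comp1 _ _ _ _ setT _ (fun u : R => 2 - u ^+ 2)) => //; first exact: smooth_eflat.
  by apply: CkB => //; [exact: Ck_cst|apply: CkX => //; exact: Ck_id].
have C2 : Ck k setT (fun u : R => eflat 0 (u ^+ 2 - 1)).
  apply: (@Ck_comp1 _ _ _ _ setT _ (fun u : R => u ^+ 2 - 1)) => //; first exact: smooth_eflat.
  by apply: CkB => //; [apply: CkX => //; exact: Ck_id|exact: Ck_cst].
apply: CkM => //; apply: CkV => [//|x _|]; first exact: cutoff_den.
exact: CkD.
Qed.

End Cutoff.

(** * Borel's lemma *)

Section Borel.
Variable R : realType.
Implicit Types (f g h : R -> R) (U : set R) (p q : {poly R}).

Lemma dn_eq U f g n : open U -> (forall x, U x -> f x = g x) ->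
  forall x, U x -> dn n f x = dn n g x.
Proof.
move=> oU fg; elim: n => [//|n IH] x Ux; rewrite !dnS.
by apply: near_eq_derive; exact: (near_open oU IH).
Qed.

Lemma dn_scale h (l a : R) k x : smooth setT h ->
  dn k (fun y => a * h (l * y)) x = a * l ^+ k * dn k h (l * x).
Proof.
move=> sh; elim: k x => [x|k IH x]; first by rewrite expr0 mulr1.
have -> : dn k.+1 (fun y => a * h (l * y)) x = 'D_1 (fun y => (a * l ^+ k) * dn k h (l * y)) x.
  by rewrite dnS; congr ('D_1 _ x); apply/funext => y; rewrite IH.
have d1 : is_derive x 1 (fun y : R => l * y) l.
  by have := @is_deriveZ _ _ _ id l x 1 1 _; rewrite /GRing.scale /= mulr1; apply; exact: is_derive_id.
have d2 := smooth_is_derive (smooth_dn k sh) (I : setT (l * x)).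
have d3 := is_derive_comp1 d1 d2.
have d4 := @is_deriveZ _ _ _ (fun y => dn k h (l * y)) (a * l ^+ k) x 1 _ d3.
transitivity ((a * l ^+ k) *: ('D_1 (dn k h) (l * x) * l)).
  by rewrite -(@derive_val _ _ _ _ _ _ _ d4).
by rewrite /GRing.scale /= exprSr; ring.
Qed.

Lemma dn_bounded h n : smooth setT h -> (forall k u, 2 < `|u| -> dn k h u = 0) ->
  exists2 M, 0 <= M & forall k, (k < n)%N -> forall u, `|dn k h u| <= M.
Proof.
move=> sh h0; elim: n => [|n [M M0 HM]]; first by exists 0.
have ct : {within `[-2, 2], continuous (fun u => `|dn n h u|)}.
  apply: continuous_subspaceT => u; apply: continuous_comp; last exact: norm_continuous.
  exact: (Ck_cont (smooth_dn n sh 0%N) I).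
have [|c _ Hc] := EVT_max _ ct; first by lra.
exists (M + `|dn n h c|); first exact: addr_ge0.
move=> k; rewrite ltnS leq_eqVlt => /orP[/eqP -> u|kn u]; last first.
  by rewrite (le_trans (HM k kn u)) // lerDl.
have [u2|u2] := ltP 2 `|u|; first by rewrite h0 // normr0 addr_ge0.
rewrite (le_trans (Hc u _)) ?lerDr //.
by move: u2; rewrite ler_norml in_itv.
Qed.

(** The term is [a x^n] times a cutoff of [l x] with [l] large. The shrinking supports make a sum of
    such terms finite away from 0, and the bounds [2^-n] make its tails uniformly small. *)
Lemma borel_term n (a : R) : exists t : R -> R,
  [/\ smooth setT t, \forall x \near (0 : R), t x = a * x ^+ n,
      forall k x, 2 < n.+1%:R * `|x| -> dn k t x = 0 &
      forall k, (k < n)%N -> forall x, `|dn k t x| <= 2 ^- n].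
Proof.
pose h (u : R) := u ^+ n * cutoff u.
have sh : smooth setT h.
  move=> k; apply: CkM; [exact: openT|apply: CkX; [exact: openT|exact: Ck_id]|exact: smooth_cutoff].
have h0 k u : 2 < `|u| -> dn k h u = 0.
  move=> u2; have o : open [set u : R | 2 < `|u|].
    apply: (@open_comp _ _ (fun u : R => `|u|) [set y | 2 < y]); last exact: open_gt.
    by move=> x _; exact: norm_continuous.
  rewrite (@dn_eq [set u : R | 2 < `|u|] h (fun=> 0)) //.
    by elim: (k) => [//|j IH]; rewrite dnSr (_ : (fun x => _) = fun=> 0) //;
      apply/funext => x; exact: derive_cst.
  move=> x /= x2; rewrite /h cutoff0 ?mulr0 // -[x ^+ 2]ger0_norm ?sqr_ge0 // normrX.
  by nra.
have [M M0 HM] := dn_bounded n sh h0.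
(* The summand [n + 1] confines the support to [|x| <= 2 / (n + 1)]. For [k < n] the k-th derivative
   carries [l^(k - n) <= 1/l], and the other summand then brings [|a| M / l] below [2^-n]. *)
pose l : R := n.+1%:R + 2 ^+ n * `|a| * M.
have tM0 : 0 <= 2 ^+ n * `|a| * M by rewrite !mulr_ge0 // exprn_ge0.
have n1 : 1 <= n.+1%:R :> R by rewrite ler1n.
have l1 : 1 <= l by rewrite /l; lra.
have l0 : 0 < l by lra.
have ln : n.+1%:R <= l by rewrite /l; lra.
have sc k x : dn k (fun y => a / l ^+ n * h (l * y)) x = a / l ^+ n * l ^+ k * dn k h (l * x).
  exact: dn_scale.
exists (fun y => a / l ^+ n * h (l * y)); split.
- move=> k; apply: CkZ; first exact: openT.
  apply: (@Ck_comp1 _ _ _ _ setT _ (fun y => l * y)) => //; first exact: openT.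
  by apply: CkZ; [exact: openT|exact: Ck_id].
- near=> x; rewrite /h cutoff1.
    by rewrite mulr1 exprMn mulrA divfK // expf_neq0 // gt_eqF.
  rewrite -[_ ^+ 2]ger0_norm ?sqr_ge0 // normrX normrM (gtr0_norm l0) exprn_ile1 //.
    by rewrite mulr_ge0 // ltW.
  rewrite -ler_pdivlMl // mulr1; apply: ltW; near: x; apply: near0_lt.
  by rewrite invr_gt0.
- move=> k x Hx; rewrite sc h0 ?mulr0 // normrM (gtr0_norm l0).
  by apply: (lt_le_trans Hx); rewrite ler_wpM2r.
- move=> k kn x; rewrite sc !normrM normfV !normrX (gtr0_norm l0).
  have H := HM k kn (l * x).
  have lk : l ^+ k / l ^+ n <= l^-1.
    rewrite ler_pdivrMr ?exprn_gt0 // -(subnKC kn) exprD exprS -mulrA mulKf ?gt_eqF //.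
    by rewrite ler_peMr ?exprn_ge0 ?exprn_ege1 // ltW.
  have -> : `|a| / l ^+ n * l ^+ k * `|dn k h (l * x)| =
    (l ^+ k / l ^+ n) * (`|a| * `|dn k h (l * x)|) by ring.
  apply: (@le_trans _ _ (l^-1 * (`|a| * M))).
    apply: ler_pM; [by rewrite divr_ge0 // exprn_ge0 // ltW|by rewrite mulr_ge0|by []|].
    exact: ler_wpM2l.
  rewrite ler_pdivrMl // ler_pdivlMr ?exprn_gt0 // /l.
  by rewrite mulrC mulrA; lra.
Unshelve. all: by end_near. Qed.

Lemma is_derive_bigsum (F G : nat -> R -> R) (x : R) M :
  (forall n, is_derive x 1 (F n) (G n x)) ->
  is_derive x 1 (fun y => \sum_(0 <= n < M) F n y) (\sum_(0 <= n < M) G n x).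
Proof.
move=> H; elim: M => [|M IH].
  apply: (@is_derive_near _ (fun=> 0) _ x).
    by apply: (@nearW _ (nbhs x)) => y; rewrite big_geq.
  by rewrite big_geq //; exact: (@is_derive_cst R R^o R^o 0 x 1).
apply: (@is_derive_near _ (fun y => \sum_(0 <= n < M) F n y + F M y) _ x).
  by apply: (@nearW _ (nbhs x)) => y; rewrite big_nat_recr.
by rewrite big_nat_recr //=; exact: is_deriveD.
Qed.

(** The difference quotient at [z] equals [f1 c] for some [c] between 0 and [z], so continuity of
    [f1] at 0 gives its limit. *)
Lemma is_derive_ext0 f f1 : {for (0 : R), continuous f} -> {for (0 : R), continuous f1} ->
  (forall x : R, x != 0 -> is_derive x 1 f (f1 x)) -> is_derive (0 : R) 1 f (f1 0).
Proof.
move=> cf cf1 df; apply/is_derive1_caratheodory.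
exists (fun z => if z == 0 then f1 0 else (f z - f 0) / z); split.
- move=> z; rewrite subr0; case: eqP => [->|/eqP z0]; first by rewrite subrr mulr0.
  by rewrite divfK.
- change ((if z == 0 then f1 0 else (f z - f 0) / z) @[z --> (0 : R)] -->
    (if (0 : R) == 0 then f1 0 else (f 0 - f 0) / 0)); rewrite eqxx.
  apply/cvgrPdist_lt => e e0.
  have [d d0 Hd] := near0_ball ((cvgrPdist_lt _ _).1 cf1 e e0).
  near=> z; have zd : `|z| < d by near: z; exact: near0_lt.
  case: eqP => [_|/eqP z0]; first by rewrite subrr normr0.
  have ct (x : R) : {for x, continuous f}.
    have [->//|x0] := eqVneq x 0.
    exact/differentiable_continuous/is_derive_differentiable/df.
  have [z1|z1|z1] := ltgtP z 0; last by rewrite z1 eqxx in z0.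
  + have [||c] := @MVT R f f1 _ _ z1.
    * by move=> x; rewrite in_itv /= => /andP[_ x0]; apply: df; rewrite lt_eqF.
    * exact: continuous_subspaceT.
    rewrite in_itv /= => /andP[zc c0] E.
    have -> : (f z - f 0) / z = f1 c by rewrite -[f z - f 0]opprB E; field.
    by apply: Hd; apply: lt_trans zd; rewrite !ltr0_norm //; lra.
  + have [||c] := @MVT R f f1 _ _ z1.
    * by move=> x; rewrite in_itv /= => /andP[x0 _]; apply: df; rewrite gt_eqF.
    * exact: continuous_subspaceT.
    rewrite in_itv /= => /andP[c0 zc] E.
    have -> : (f z - f 0) / z = f1 c by rewrite E; field.
    by apply: Hd; apply: lt_trans zd; rewrite !gtr0_norm //; lra.
- by rewrite eqxx.
Unshelve. all: by end_near. Qed.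

Lemma sum_geo_tail N M : \sum_(N <= n < M) (2 : R) ^- n <= 2 * 2 ^- N.
Proof.
have [MN|NM] := leqP M N; first by rewrite big_geq // mulr_ge0 // invr_ge0 exprn_ge0.
suff -> : \sum_(N <= n < M) (2 : R) ^- n = 2 * 2 ^- N - 2 * 2 ^- M.
  by rewrite gerBl mulr_ge0 // invr_ge0 exprn_ge0.
rewrite -(subnKC (ltnW NM)); elim: (M - N)%N => [|k IH].
  by rewrite addn0 big_geq // subrr.
rewrite addnS big_nat_recr ?leq_addr //= IH exprS invfM; field.
by rewrite !expf_neq0.
Qed.

(* The sums [S M k] of k-th derivatives are stationary in [M], uniformly away from [x = 0]; at 0 only
   continuity has to be checked, the derivative being then recovered by [is_derive_ext0]. *)
Lemma borel (c : nat -> R) : exists f : R -> R,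
  smooth setT f /\ forall n, dn n f 0 = n`!%:R * c n.
Proof.
have /choice [t Ht] := fun n => borel_term n (c n).
have ts n : smooth setT (t n) by have [] := Ht n.
have t0 k n : dn k (t n) 0 = k`!%:R * (if k == n then c n else 0).
  have [_ H _ _] := Ht n.
  have Hp : tay k.+1 (t n) (c n *: 'X^n).
    apply: tay_eq (tay_poly k.+1 _); apply: filterS H => x ->.
    by rewrite hornerZ hornerXn.
  rewrite (dn_tay openT I (ts n) Hp) // coefZ coefXn; case: eqP => _.
    by rewrite mulr1.
  by rewrite mulr0.
(* From index [N k x] on, the k-th derivatives of the terms vanish at [x]: by their supports if
   [x != 0]; at [x = 0], where [2 / 0 = 0] leaves [k + 2], because only the term of index [k]
   contributes there. *)
pose N k (x : R) := (k.+2 + Num.truncn (2 / `|x|))%N.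
pose S M k (x : R) := \sum_(0 <= n < M) dn k (t n) x.
pose F k x := S (N k x) k x.
have stab k x M : (N k x <= M)%N -> S M k x = F k x.
  move=> NM; rewrite /F /S (big_cat_nat (leq0n (N k x)) NM) /= [X in _ + X]big_nat_cond [X in _ + X]big1 ?addr0 //.
  move=> n /andP[/andP[Nn _] _]; have [->|x0] := eqVneq x 0.
    rewrite t0; case: eqP => [E|_]; last by rewrite mulr0.
    by move: Nn; rewrite /N -E => /(leq_trans (leq_addr _ _)); rewrite ltnNge leqnSn.
  have [_ _ H _] := Ht n; apply: H.
  rewrite -ltr_pdivrMr ?normr_gt0 //.
  apply: (lt_le_trans (truncnS_gt _)); rewrite ler_nat ltnS.
  exact: (leq_trans (leq_addl _ _) Nn).
have dS M k (x : R) : is_derive x 1 (S M k) (S M k.+1 x).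
  apply: (@is_derive_bigsum (fun n => dn k (t n)) (fun n => dn k.+1 (t n))) => n.
  exact: smooth_is_derive (smooth_dn k (ts n)) I.
have dF k (x : R) : x != 0 -> is_derive x 1 (F k) (F k.+1 x).
  move=> x0; have nx0 : 0 < `|x| by rewrite normr_gt0.
  (* One index that serves both [F k] and [F k.+1], at [x] and at every [y] with
     [|y| >= |x| / 2]. *)
  pose M := (k.+3 + Num.truncn (2 / (`|x| / 2)))%N.
  have HM y j : (j <= k.+1)%N -> `|x| / 2 <= `|y| -> (N j y <= M)%N.
    move=> jk xy; rewrite /N /M; apply: leq_add => //; apply: le_truncn.
    by rewrite ler_pM2l // lef_pV2 // posrE; lra.
  rewrite -(stab _ _ M); last by apply: HM => //; lra.
  apply: (@is_derive_near _ (S M k) _ x) => //.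
  have : \forall y \near x, `|x| / 2 < `|y|.
    apply: (@near_open _ _ [set y : R | `|x| / 2 < `|y|]) => //=; last by lra.
    apply: (@open_comp _ _ (fun u : R => `|u|) [set y | `|x| / 2 < y]); last exact: open_gt.
    by move=> z _; exact: norm_continuous.
  by apply: filterS => y xy; apply: stab; apply: HM => //; exact: ltW.
have cF k : {for (0 : R), continuous (F k)}.
  change (F k y @[y --> (0 : R)] --> F k 0); apply/cvgrPdist_lt => e e0.
  have [n0 Hn0] : exists n0, 2 * 2 ^- n0 < e / 2 :> R.
    have e4 : 0 < e / 4 by lra.
    exists (Num.truncn (e / 4)^-1).+1; rewrite -ltr_pdivlMl //.
    have -> : 2^-1 * (e / 2) = e / 4 by lra.
    rewrite -[ltRHS]invrK ltf_pV2 ?posrE ?invr_gt0 ?exprn_gt0 //.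
    apply: (lt_trans (truncnS_gt _)).
    by rewrite -natrX ltr_nat ltn_expl.
  (* The sum up to [N0] is a fixed continuous function, equal to [F k] at 0. Past [N0] every index
     exceeds [k], so the terms are at most [2^-n] at any [y] and their sum is below [e / 2]. *)
  pose N0 := maxn n0 (N k 0).
  have cS : {for (0 : R), continuous (S N0 k)}.
    exact: (differentiable_continuous (is_derive_differentiable (dS N0 k 0))).
  have /cvgrPdist_lt /(_ (e / 2)) H : S N0 k y @[y --> (0 : R)] --> S N0 k 0 := cS.
  have {}H := H (divr_gt0 e0 (ltr0Sn _ _)).
  apply: filterS H => y Hy; rewrite -(stab k 0 N0) ?leq_maxr //.
  rewrite -(stab k y (maxn N0 (N k y))) ?leq_maxr //.
  rewrite {2}/S (big_cat_nat (leq0n N0) (leq_maxl N0 (N k y))) /= -/(S N0 k y) opprD addrA.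
  apply: (le_lt_trans (ler_normB _ _)); rewrite (splitr e) ltr_leD //.
  apply: (le_trans (ler_norm_sum _ _ _)).
  apply: (@le_trans _ _ (\sum_(N0 <= n < maxn N0 (N k y)) 2 ^- n)).
    rewrite big_nat_cond [leRHS]big_nat_cond; apply: ler_sum => n /andP[/andP[Nn _] _].
    have [_ _ _ H] := Ht n; apply: H; apply: leq_trans Nn.
    by rewrite leq_max /N; apply/orP; right; apply: leq_trans (leq_addr _ _); exact: leqnSn.
  apply: (le_trans (sum_geo_tail _ _)); apply: le_trans (ltW Hn0).
  rewrite ler_pM2l // lef_pV2 ?posrE ?exprn_gt0 //.
  by rewrite ler_weXn2l ?ler1n // leq_maxl.
have dF' k (x : R) : is_derive x 1 (F k) (F k.+1 x).
  have [->|x0] := eqVneq x 0; last exact: dF.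
  exact: (is_derive_ext0 (cF k) (cF k.+1) (dF k)).
exists (F 0%N); split; first exact: (smooth_seq openT (fun n x _ => dF' n x) 0%N).
move=> n; have -> : dn n (F 0%N) = F n.
  elim: n => [//|n IH]; apply/funext => x; rewrite dnS IH.
  by have h := dF' n x; rewrite derive_val.
have nN : (n < N n 0%R)%N by apply: leq_trans (leq_addr _ _); exact: leqnSn.
rewrite /F /S (eq_bigr (fun m => if m == n then n`!%:R * c n else 0)); last first.
  by move=> m _; rewrite t0 eq_sym; case: eqP => [->|_] //; rewrite mulr0.
rewrite -big_mkcond /= big_mkord /= (big_pred1 (Ordinal (nN : (n < N n 0%R)%N))) //.
Qed.

End Borel.

(** * Flat functions of the fifth root *)

Section FifthRoot.
Variable R : realType.
Implicit Types (f g h : R -> R) (U : set R) (p q : {poly R}).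

(** The power function yields the real root for nonnegative arguments only; the other branch is its
    odd extension. *)
Definition r5 (y : R) : R := if 0 <= y then y `^ 5^-1 else - (- y) `^ 5^-1.

Lemma r5X y : r5 y ^+ 5 = y.
Proof.
have H (z : R) : 0 <= z -> (z `^ 5^-1) ^+ 5 = z.
  by move=> z0; rewrite -powR_mulrn ?powR_ge0 // -powRrM mulVf // powRr1.
rewrite /r5; case: ifPn => [/H //|]; rewrite -ltNge => y0.
by rewrite exprNn H ?oppr_ge0 ?ltW // -[_ ^+ 5]signr_odd /= expr1 mulN1r opprK.
Qed.

Lemma r5K t : r5 (t ^+ 5) = t.
Proof.
have H (z : R) : 0 <= z -> (z ^+ 5) `^ 5^-1 = z.
  by move=> z0; rewrite -powR_mulrn // -powRrM mulfV // powRr1.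
have [t0|t0] := leP 0 t; rewrite /r5; first by rewrite exprn_ge0 // H.
have E : t ^+ 5 = - (- t) ^+ 5 by ring.
have t5 : 0 < (- t) ^+ 5 by rewrite exprn_gt0 // oppr_gt0.
by rewrite {1}E oppr_ge0 leNgt t5 /= E opprK H ?opprK // oppr_ge0 ltW.
Qed.

Lemma r5_0 : r5 0 = 0.
Proof. by have := r5K 0; rewrite expr0n. Qed.

Lemma r5_eq0 y : (r5 y == 0) = (y == 0).
Proof. by apply/eqP/eqP => [E|->]; [rewrite -(r5X y) E expr0n|exact: r5_0]. Qed.

Lemma norm_r5 y : `|r5 y| ^+ 5 = `|y|.
Proof. by rewrite -normrX r5X. Qed.

Lemma is_derive_exp n (x : R) : is_derive x 1 (fun t : R => t ^+ n) (n%:R * x ^+ n.-1).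
Proof.
apply: DeriveDef; first exact: exprn_derivable.
by rewrite exp_derive /GRing.scale /= mulr1.
Qed.

Lemma is_derive_r5 (y : R) : y != 0 -> is_derive y 1 r5 (5 * r5 y ^+ 4)^-1.
Proof.
move=> y0; have t0 : r5 y != 0 by rewrite r5_eq0.
rewrite -{1}(r5X y); apply: (@is_derive_inverse _ (fun t => t ^+ 5)).
- by apply: (@nearW _ (nbhs (r5 y))) => t; exact: r5K.
- by apply: (@nearW _ (nbhs (r5 y))) => t; exact: exprn_continuous.
- exact: is_derive_exp.
- by rewrite mulf_neq0 // ?expf_neq0 // pnatr_eq0.
Qed.

Lemma r5_lt (e y : R) : 0 < e -> `|y| < e ^+ 5 -> `|r5 y| < e.
Proof.
by move=> e0; rewrite -norm_r5 ltr_pXn2r // nnegrE // ltW.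
Qed.

Lemma r5_continuous : continuous r5.
Proof.
move=> y; have [->|y0] := eqVneq y 0.
  change (r5 z @[z --> (0 : R)] --> r5 0); rewrite r5_0.
  apply/cvgrPdist_lt => e e0; near=> z; rewrite sub0r normrN; apply: r5_lt => //.
  by near: z; apply: near0_lt; exact: exprn_gt0.
exact/differentiable_continuous/is_derive_differentiable/is_derive_r5.
Unshelve. all: by end_near. Qed.

Lemma flat_tay U f n : open U -> U 0 -> smooth U f -> (forall k, dn k f 0 = 0) -> Ot n f.
Proof.
move=> oU U0 sf f0; have := taylor n oU U0 sf.
have -> : tpoly n f = 0 by apply/polyP => i; rewrite coef_poly f0 mul0r coef0 if_same.
by apply: Ot_eq; apply: (@nearW _ (nbhs (0 : R))) => t; rewrite horner0 subr0.
Qed.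

Lemma dn_dn f k j : dn k (dn j f) = dn (k + j) f.
Proof. by elim: k => [//|k IH]; apply/funext => x; rewrite addSn !dnS IH. Qed.

(* [0^-1 = 0] makes [t ^- m * dn j r t] vanish at [t = 0]. *)
Lemma smooth_flat_r5 U f : open U -> U 0 -> smooth U f -> (forall k, dn k f 0 = 0) ->
  smooth [set y | U (r5 y)] (fun y => f (r5 y)).
Proof.
move=> oU U0 sf f0; pose V := [set y | U (r5 y)].
have oV : open V by apply: (@open_comp _ _ r5 U) => // x _; exact: r5_continuous.
(* As the derivative of [y^(1/5)] is [t^-4 / 5] with [t = r5 y], this family is closed under
   differentiation up to linear combinations, so one induction on the class treats all its members
   together. *)
pose G m j (y : R) := (r5 y ^+ m)^-1 * dn j f (r5 y).
have G0 m j : G m j 0 = 0 by rewrite /G r5_0 f0 mulr0.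
have dG m j (y : R) : V y -> is_derive y 1 (G m j)
    (- (m%:R / 5) * G (m + 5)%N j y + 5^-1 * G (m + 4)%N j.+1 y).
  move=> Vy; have [->|y0] := eqVneq y 0.
    rewrite !G0 !mulr0 addr0; apply: is_derive_Ot2.
    (* After division by [t^m], order 10 in [t] remains, which is order 2 in [y = t^5]. *)
    have [C HC] : Ot (m + 10) (dn j f).
      apply: (flat_tay _ oU U0 (smooth_dn j sf)) => k.
      by rewrite dn_dn.
    have [e e0 He] := near0_ball HC; exists `|C|; near=> z.
    have [->|z0] := eqVneq z 0; first by rewrite G0 normr0 mulr_ge0 // exprn_ge0.
    have H : `|dn j f (r5 z)| <= C * `|r5 z| ^+ (m + 10).
      by apply: He; apply: r5_lt => //; near: z; apply: near0_lt; exact: exprn_gt0.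
    have t0 : 0 < `|r5 z| by rewrite normr_gt0 r5_eq0.
    rewrite /G normrM normfV normrX ler_pdivrMl ?exprn_gt0 //.
    apply: (le_trans H); rewrite exprD -(norm_r5 z) -exprM mulrCA.
    by apply: ler_wpM2l; rewrite ?exprn_ge0 // ler_wpM2r ?ler_norm // exprn_ge0.
  have t0 : r5 y != 0 by rewrite r5_eq0.
  have d5 := is_derive_r5 y0.
  have dj := smooth_is_derive (smooth_dn j sf) Vy.
  have dX := is_derive_exp m (r5 y).
  have tm : r5 y ^+ m != 0 by rewrite expf_neq0.
  have dV := @is_deriveV _ (fun t => t ^+ m) (r5 y) _ 1 tm dX.
  have := is_derive_comp1 d5 (is_deriveM dV dj).
  move=> H; apply: is_derive_eq H _.
  rewrite /GRing.scale /= -dnS /G; move: (dn j.+1 f (r5 y)) (dn j f (r5 y)) => A B.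
  rewrite !exprD; case: (m) tm => [|k] tm /=.
    by field.
  rewrite exprS in tm *; have tk : r5 y ^+ k != 0 by rewrite expf_neq0.
  by field; rewrite t0 tk.
have CG k m j : Ck k V (G m j).
  elim: k m j => [|k IH] m j.
    by move=> y Vy; exact: (differentiable_continuous (is_derive_differentiable (dG m j y Vy))).
  apply: (Ck_of_derive oV (dG m j)).
  exact: (CkD oV (CkZ _ oV (IH _ _)) (CkZ _ oV (IH _ _))).
move=> k; apply: Ck_eq (CG k 0%N 0%N) => // y _.
by rewrite /G expr0 invr1 mul1r.
Unshelve. all: by end_near. Qed.

Lemma is_derive_pt (F : 'rV[R]_2 -> R) (u v : R -> R) (s a b : R) :
  differentiable F (pt (u s) (v s)) -> is_derive s 1 u a -> is_derive s 1 v b ->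
  is_derive s 1 (fun s => F (pt (u s) (v s)))
    ('D_(pt 1 0) F (pt (u s) (v s)) * a + 'D_(pt 0 1) F (pt (u s) (v s)) * b).
Proof.
move=> dF hu hv; have du := is_derive_differentiable hu; have dv := is_derive_differentiable hv.
have [dp Edp] := diff_pt du dv.
have dFp : differentiable (F \o (fun s => pt (u s) (v s))) s by exact: differentiable_comp.
apply: DeriveDef; first exact: diff_derivable.
have -> : 'D_1 (fun x => F (pt (u x) (v x))) s =
    'd F (pt (u s) (v s)) ('d (fun x => pt (u x) (v x)) s (1 : R)).
  exact: etrans (deriveE (1 : R) dFp) (congr1 (fun G : R -> R => G 1) (diff_comp dp dF)).
rewrite Edp -(deriveE (1 : R) du) -(deriveE (1 : R) dv) !derive_val.
rewrite (pt_lin a) linearD !linearZ /= (deriveE (pt 1 0) dF) (deriveE (pt 0 1) dF).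
by rewrite mulrC [X in _ + X]mulrC.
Qed.

Lemma Ot_int f g n : (\forall t \near (0 : R), is_derive (t : R) 1 f (g t)) -> Ot n g ->
  Ot n.+1 (fun t => f t - f 0).
Proof.
move=> df [C HC]; have [e e0 He] := near0_ball (filterI df HC).
exists C; near=> t; apply: (@mvt_pow _ f g e) => [x xe|x xe|].
- by have [] := He x xe.
- by have [] := He x xe.
- by near: t; exact: near0_lt.
Unshelve. all: by end_near. Qed.

End FifthRoot.

(** * Factorisation through the cusp *)

Section Cusp.
Variable R : realType.
Implicit Types (f g h : R -> R) (U : set R) (p q : {poly R}).
Notation e1 := (pt (1 : R) 0).
Notation e2 := (pt (0 : R) 1).
Notation cusp F := (fun s : R => F (pt (s ^+ 4) (s ^+ 5))).

Lemma smooth_pow n k U : Ck k U (fun t : R => t ^+ n).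
Proof.
apply: CkS (_ : U `<=` setT) _ => //.
by apply: CkX; [exact: openT|exact: Ck_id].
Qed.

Lemma derive_coord (i : 'I_2) (p v : 'rV[R]_2) : 'D_v (fun q : 'rV[R]_2 => q 0 i) p = v 0 i.
Proof.
have := derive_mx (@derivable_id _ _ p v); rewrite derive_id => E.
by rewrite [in RHS]E mxE.
Qed.

Lemma is_derive_coord (i : 'I_2) (p v : 'rV[R]_2) :
  is_derive p v (fun q : 'rV[R]_2 => q 0 i) (v 0 i).
Proof.
by apply: DeriveDef; [apply: diff_derivable; exact: differentiable_coord|exact: derive_coord].
Qed.

Lemma Ck_coord V k (i : 'I_2) : Ck k V (fun q : 'rV[R]_2 => q 0 i).
Proof.
case: k => [q _|k]; first exact: coord_continuous.
split=> [q _|v]; first exact: differentiable_coord.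
have -> : (fun q : 'rV[R]_2 => 'D_v (fun q : 'rV[R]_2 => q 0 i) q) = (fun=> v 0 i).
  by apply/funext => q; exact: derive_coord.
exact: Ck_cst.
Qed.

Lemma continuous_cusp t : {for t, continuous (fun t : R => pt (t ^+ 4) (t ^+ 5))}.
Proof.
apply: differentiable_continuous.
exact: (proj1 (diff_pt (is_derive_differentiable (is_derive_exp 4 t))
                       (is_derive_differentiable (is_derive_exp 5 t)))).
Qed.

Lemma near_cusp (V : set 'rV[R]_2) : open V -> V (pt 0 0) ->
  \forall t \near (0 : R), V (pt (t ^+ 4) (t ^+ 5)).
Proof.
move=> oV V0; have := @continuous_cusp 0; rewrite /prop_for /continuous_at !expr0n /=.
by move/(_ V); apply; exact: open_nbhs_nbhs.
Qed.

(** The factor [t^3] is isolated because it makes a bracket of order [n] yield, after integration,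
    an increment of order [n + 4]. *)
Lemma is_derive_cusp (V : set 'rV[R]_2) k F : open V -> V (pt 0 0) -> Ck k.+1 V F ->
  \forall t \near (0 : R), is_derive (t : R) 1 (cusp F)
    (t ^+ 3 * (4 * 'D_e1 F (pt (t ^+ 4) (t ^+ 5)) + 5 * t * 'D_e2 F (pt (t ^+ 4) (t ^+ 5)))).
Proof.
move=> oV V0 [dF _]; apply: filterS (near_cusp oV V0) => t /dF dFt.
have H := @is_derive_pt _ F (fun s => s ^+ 4) (fun s => s ^+ 5) t _ _ dFt
  (is_derive_exp 4 t) (is_derive_exp 5 t).
apply: (@is_derive_eq _ _ _ (fun s : R => F (pt (s ^+ 4) (s ^+ 5))) t 1 _ _ H).
by move: ('D_e1 F _) ('D_e2 F _) => A B /=; ring.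
Qed.

Lemma Ot0_cusp (V : set 'rV[R]_2) F : open V -> V (pt 0 0) -> Ck 0 V F -> Ot 0 (cusp F).
Proof.
move=> oV V0 cF; apply: Ot_cont.
have : Ck 0 [set (0 : R)] (cusp F).
  move=> t ->; apply: (@continuous_comp _ _ _ (fun t : R => pt (t ^+ 4) (t ^+ 5))).
    exact: continuous_cusp.
  by apply: cF; rewrite !expr0n.
exact.
Qed.

Lemma Ot4_cusp (V : set 'rV[R]_2) F : open V -> V (pt 0 0) -> Ck 1 V F ->
  Ot 4 (fun t => cusp F t - F (pt 0 0)).
Proof.
move=> oV V0 CF; have [dF DF] := CF.
have -> : F (pt 0 0) = cusp F 0 by rewrite !expr0n.
apply: Ot_int (is_derive_cusp oV V0 CF) _.
apply: (@OtM _ 3 0); first exact: Ot_X.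
have Oc (c : R) : Ot 0 (fun=> c) by apply: Ot_cont; exact: cst_continuous.
apply: OtD; first by apply: (@OtM _ 0 0); [exact: Oc|exact: Ot0_cusp (DF e1)].
apply: (@OtM _ 0 0); last exact: Ot0_cusp (DF e2).
by apply: (@OtM _ 0 0); [exact: Oc|exact: OtW (Ot_X _ 1)].
Qed.

(** After [x] and [y] the next monomial is [x^2 = t^8]. [Ot4_cusp] applied to both partial
    derivatives gives the bracket of the derivative order 4, and integration brings the remainder to
    order 8. *)
Lemma cusp_expand (V : set 'rV[R]_2) F : open V -> V (pt 0 0) -> Ck 2 V F ->
  tay 8 (cusp F) ((F (pt 0 0))%:P + ('D_e1 F (pt 0 0)) *: 'X^4 + ('D_e2 F (pt 0 0)) *: 'X^5).
Proof.
move=> oV V0 CF; have [dF DF] := CF.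
set a := 'D_e1 F (pt 0 0); set b := 'D_e2 F (pt 0 0).
pose g t := cusp F t - (a * t ^+ 4 + b * t ^+ 5).
pose g' t := t ^+ 3 * (4 * (cusp ('D_e1 F) t - a) + 5 * t * (cusp ('D_e2 F) t - b)).
have Ha := Ot4_cusp oV V0 (DF e1); have Hb := Ot4_cusp oV V0 (DF e2).
have Oc (c : R) : Ot 0 (fun=> c) by apply: Ot_cont; exact: cst_continuous.
have Og' : Ot 7 g'.
  apply: (@OtM _ 3 4); first exact: Ot_X.
  apply: OtD; first by apply: (@OtM _ 0 4); [exact: Oc|exact: Ha].
  apply: (@OtM _ 0 4); last exact: Hb.
  by apply: (@OtM _ 0 0); [exact: Oc|exact: OtW (Ot_X _ 1)].
have dg : \forall t \near (0 : R), is_derive (t : R) 1 g (g' t).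
  apply: filterS (is_derive_cusp oV V0 CF) => t Ht.
  have d4 := @is_deriveZ _ _ _ (fun t : R => t ^+ 4) a t 1 _ (is_derive_exp 4 t).
  have d5 := @is_deriveZ _ _ _ (fun t : R => t ^+ 5) b t 1 _ (is_derive_exp 5 t).
  apply: is_derive_eq (is_deriveB Ht (is_deriveD d4 d5)) _.
  rewrite /g' /GRing.scale /=.
  by move: ('D_e1 F (pt (t ^+ 4) _)) ('D_e2 F (pt (t ^+ 4) _)) => A B; ring.
apply: Ot_eq (Ot_int dg Og'); apply: (@nearW _ (nbhs (0 : R))) => t.
rewrite !hornerD hornerC !hornerZ !hornerXn /g !expr0n /=.
by move: (F (pt (t ^+ 4) _)) (F (pt 0 0)) => A B; ring.
Qed.

(* The monomials [x^i y^j] with [j < 4] pull back to distinct powers [t^(4i+5j)], which are all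
   powers of [t] except the six gaps [1, 2, 3, 6, 7, 11]; Borel's lemma realises the formal
   factorisation, and what is left is flat, hence a smooth function of [y = t^5] alone. *)
Lemma semigroup_factor U f : open U -> U 0 -> smooth U f ->
  {in [:: 1; 2; 3; 6; 7; 11]%N, forall i, dn i f 0 = 0} ->
  exists (V : set 'rV[R]_2) F,
    [/\ open V, V (pt 0 0), smooth V F & \forall t \near (0 : R), F (pt (t ^+ 4) (t ^+ 5)) = f t].
Proof.
move=> oU U0 sf f0; pose c n := dn n f 0 / n`!%:R.
have c0 n : n \in [:: 1; 2; 3; 6; 7; 11]%N -> c n = 0.
  by move=> /f0 E; rewrite /c E mul0r.
(* The Taylor coefficients of [g b] are prescribed so that [t^(5b) g_b(t^4)] carries formally the
   terms of [f] with exponents [4a + 5b]. *)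
have [g Hg] := choice (fun b => borel (fun a => c (4 * a + 5 * b)%N)).
have sg b : smooth setT (g b) by have [] := Hg b.
pose r t := f t - \sum_(b < 4) t ^+ (5 * b) * g b (t ^+ 4).
have sr : smooth U r.
  move=> k; apply: CkB => //; apply: Ck_sum => // b; apply: CkM => //; first exact: smooth_pow.
  by apply: (@Ck_comp1 _ _ _ _ setT) => //; [exact: sg|exact: smooth_pow].
have r0 n : dn n r 0 = 0.
  have Hf := taylor n.+1 oU U0 sf.
  have Hgb b : tay n.+1 (g b) (tpoly n.+1 (g b)) by exact: taylor openT I (sg b).
  have HX m : tay n.+1 (fun t : R => t ^+ m) 'X^m.
    by apply: tay_eq (tay_poly n.+1 'X^m); apply: (@nearW _ (nbhs (0 : R))) => t; rewrite hornerXn.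
  have Hb b : tay n.+1 (fun t => t ^+ (5 * b) * g b (t ^+ 4))
     ('X^(5 * b) * (tpoly n.+1 (g b) \Po 'X^4)).
    apply: tayM (HX _) _; apply: tay_comp (Hgb b) (HX 4%N) _.
    by apply: OtW (Ot_X _ 4).
  have Hs : tay n.+1 r (tpoly n.+1 f + (-1)%:P *
      \sum_(b < 4) 'X^(5 * b) * (tpoly n.+1 (g b) \Po 'X^4)).
    apply: (@tay_eq _ _ (fun t => f t + -1 * \sum_(b < 4) t ^+ (5 * b) * g b (t ^+ 4))).
      by apply: (@nearW _ (nbhs (0 : R))) => t; rewrite mulN1r.
    apply: tayD Hf _; apply: tayM (tay_cst _ _) _; rewrite !big_ord_recr !big_ord0 /=.
    apply: (@tay_eq _ _ (fun t => 0 + t ^+ (5 * 0) * g 0%N (t ^+ 4) + t ^+ (5 * 1) * g 1%N (t ^+ 4)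
      + t ^+ (5 * 2) * g 2%N (t ^+ 4) + t ^+ (5 * 3) * g 3%N (t ^+ 4))).
      by apply: (@nearW _ (nbhs (0 : R))) => t; rewrite !big_ord_recr big_ord0 /=.
    by apply: tayD (Hb 3); apply: tayD (Hb 2); apply: tayD (Hb 1); apply: tayD (tay_cst _ 0) (Hb 0).
  rewrite (dn_tay oU U0 sr Hs) // coefD coefCM coef_sum tpoly_coef // -/(c n).
  (* Since [5b] is congruent to [b] modulo 4, only [b = n %% 4] can produce [t^n], and it does so
     unless [5b > n]; the latter happens exactly for the six gaps. *)
  have Et b : (b < 4)%N -> ('X^(5 * b) * (tpoly n.+1 (g b) \Po 'X^4))`_n =
      if (b == n %% 4)%N && (5 * b <= n)%N then c n else 0.
    move=> b4; rewrite coefXnM; case: (ltnP n (5 * b)) => nb; first by rewrite andbF.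
    rewrite andbT coef_comp_poly_Xn // tpoly_coef; last by rewrite ltnS (leq_trans (leq_div _ _)) // leq_subr.
    have [_ ->] := Hg b; have [E|E] := eqVneq b (n %% 4)%N.
      have -> : (4 %| n - 5 * b)%N by lia.
      have -> : (4 * ((n - 5 * b) %/ 4) + 5 * b)%N = n by lia.
      by field; rewrite pnatr_eq0 -lt0n fact_gt0.
    by have -> : (4 %| n - 5 * b)%N = false by lia.
  rewrite (eq_bigr (fun b : 'I_4 => if (b == n %% 4 :> nat)%N && (5 * b <= n)%N then c n else 0)); last first.
    by move=> b _; exact: Et.
  rewrite !big_ord_recr big_ord0 /=.
  have [nb|nb] := leqP (5 * (n %% 4)) n.
    have : (n %% 4 < 4)%N by rewrite ltn_mod.
    by move: nb; case: (n %% 4)%N => [|[|[|[|//]]]] nb _ /=; rewrite ?nb /=; ring.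
  have E : n \in [:: 1; 2; 3; 6; 7; 11]%N.
    by rewrite !inE; lia.
  by rewrite (c0 _ E) !if_same; ring.
pose V := [set q : 'rV[R]_2 | U (r5 (q 0 1))].
have oV : open V.
  apply: (@open_comp _ _ (fun q : 'rV[R]_2 => r5 (q 0 1)) U) => // q _.
  apply: continuous_comp; [exact: coord_continuous|exact: r5_continuous].
exists V, (fun q : 'rV[R]_2 => \sum_(b < 4) q 0 1 ^+ b * g b (q 0 0) + r (r5 (q 0 1))); split => //.
- by rewrite /V /= pt1 r5_0.
- move=> k; apply: CkD => //.
    apply: Ck_sum => // b; apply: CkM => //; first by apply: CkX => //; exact: Ck_coord.
    by apply: (@Ck_comp1 _ _ _ _ setT) => //; [exact: sg|exact: Ck_coord].
  apply: (@Ck_comp1 _ _ _ _ [set y | U (r5 y)] (fun y => r (r5 y))) => //.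
    exact: smooth_flat_r5.
  exact: Ck_coord.
- apply: (@nearW _ (nbhs (0 : R))) => t; rewrite /r pt0 pt1 r5K.
  have -> : \sum_(b < 4) (t ^+ 5) ^+ b * g b (t ^+ 4) = \sum_(b < 4) t ^+ (5 * b) * g b (t ^+ 4).
    by apply: eq_bigr => b _; rewrite -exprM.
  by move: (\sum_(b < 4) _) => S; rewrite addrC subrK.
Qed.

End Cusp.

(** Joins completeness to the norm of the plane, as required by the Banach fixed point theorem in
    [fixed_point2]. *)
HB.instance Definition _ (R : realType) := Complete.copy 'rV[R]_2 'rV[R]_2.

(** * The inverse function theorem in the plane *)

Section Inverse.
Variable R : realType.
Implicit Types (V U W : set 'rV[R]_2) (F : 'rV[R]_2 -> R).
Notation e1 := (pt (1 : R) 0).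
Notation e2 := (pt (0 : R) 1).

Lemma norm_le2 (p : 'rV[R]_2) (M : R) : (`|p| <= M) = (`|p 0 0| <= M) && (`|p 0 1| <= M).
Proof.
rewrite [`|p|]/Num.Def.normr /= mx_normrE; apply/bigmax_leP/andP => [[M0 H]|[H0 H1]].
  by split; [exact: (H (0, 0))|exact: (H (0, 1))].
split; first exact: le_trans H0.
case=> i j _ /=; rewrite (ord1 i); case: j => -[|[|//]] Hj.
  by rewrite (_ : Ordinal Hj = 0) //; exact/val_inj.
by rewrite (_ : Ordinal Hj = 1) //; exact/val_inj.
Qed.

Lemma norm_coord (p : 'rV[R]_2) : `|p 0 0| <= `|p| /\ `|p 0 1| <= `|p|.
Proof. by have := norm_le2 p `|p|; rewrite lexx => /esym/andP. Qed.

Lemma deriveE2 F p v : differentiable F p ->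
  'D_v F p = v 0 0 * 'D_e1 F p + v 0 1 * 'D_e2 F p.
Proof.
move=> dF; rewrite !(deriveE _ dF) -{1}(ptK v) pt_lin linearD !linearZ.
by [].
Qed.

(** A ball contains the segment between two of its points, so the one-variable mean value theorem
    applies along it. The norm is the maximum norm: the two partial derivatives contribute
    [c |p - q|] each, whence the factor 2. *)
Lemma mvt2 F (p0 : 'rV[R]_2) (r c : R) : (forall p, `|p - p0| < r -> differentiable F p) ->
  (forall p, `|p - p0| < r -> `|'D_e1 F p| <= c /\ `|'D_e2 F p| <= c) ->
  forall p q, `|p - p0| < r -> `|q - p0| < r -> `|F p - F q| <= 2 * c * `|p - q|.
Proof.
move=> dF bF p q pr qr.
pose u t := q 0 0 + t * (p 0 0 - q 0 0); pose v t := q 0 1 + t * (p 0 1 - q 0 1).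
have E t : pt (u t) (v t) = q + t *: (p - q).
  by rewrite -[RHS]ptK !mxE.
have B t : 0 <= t <= 1 -> `|pt (u t) (v t) - p0| < r.
  move=> /andP[t0 t1]; rewrite E.
  have -> : q + t *: (p - q) - p0 = (1 - t) *: (q - p0) + t *: (p - p0).
    by apply/rowP => i; rewrite !mxE; ring.
  apply: (le_lt_trans (ler_normD _ _)); rewrite !normrZ (ger0_norm t0) ger0_norm ?subr_ge0 //.
  move: pr qr; set x := `|p - p0|; set y := `|q - p0| => xr yr.
  have [xy|yx] := leP x y; first by apply: le_lt_trans yr; nra.
  by apply: le_lt_trans xr; nra.
have d (t : R) (x y : R) : is_derive t 1 (fun t => x + t * y) y.
  have h := is_derive_poly (x%:P + y *: 'X) t.
  rewrite derivD derivC derivZ derivX add0r hornerZ hornerC mulr1 in h.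
  by apply: is_derive_near h; apply: (@nearW _ (nbhs t)) => s; rewrite !hornerE mulrC.
pose df t := 'D_e1 F (pt (u t) (v t)) * (p 0 0 - q 0 0) + 'D_e2 F (pt (u t) (v t)) * (p 0 1 - q 0 1).
have dG (t : R) : 0 <= t <= 1 -> is_derive t 1 (fun t => F (pt (u t) (v t))) (df t).
  move=> t01; exact: (@is_derive_pt _ F u v t _ _ (dF _ (B t t01)) (d t _ _) (d t _ _)).
have [||t] := @MVT R (fun t => F (pt (u t) (v t))) df 0 1 ltr01.
- by move=> t; rewrite in_itv /= => /andP[/ltW t0 /ltW t1]; apply: dG; rewrite t0.
- apply: continuous_in_subspaceT => t; rewrite inE /= in_itv /= => t01.
  exact: (differentiable_continuous (is_derive_differentiable (dG t t01))).
have E1 : pt (u 1) (v 1) = p by rewrite E scale1r addrC subrK.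
have E0 : pt (u 0) (v 0) = q by rewrite E scale0r addr0.
rewrite in_itv /= => /andP[/ltW t0 /ltW t1]; rewrite E1 E0 subr0 mulr1.
move=> ->; have [H1 H2] := bF _ (B t (introT andP (conj t0 t1))).
have [N1 N2] := norm_coord (p - q); rewrite !mxE in N1 N2.
rewrite /df (le_trans (ler_normD _ _)) // !normrM.
apply: (le_trans (lerD (ler_pM _ _ H1 N1) (ler_pM _ _ H2 N2))) => //.
by rewrite -mulr2n -mulrA mulr_natl.
Qed.

Definition lin2 (a b : R) (h : 'rV[R]_2) : R := a * h 0 0 + b * h 0 1.

Lemma lin2_diff a b p : differentiable (lin2 a b) p /\ forall h, 'd (lin2 a b) p h = lin2 a b h.
Proof.
have dl : differentiable (lin2 a b) p.
  have [H _] : Ck 1 setT (lin2 a b) by apply: CkD; [exact: openT| |];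
    apply: CkZ; [exact: openT|exact: Ck_coord|exact: openT|exact: Ck_coord].
  exact: H.
split=> // h; rewrite -(deriveE h dl).
have d (i : 'I_2) (c : R) : is_derive p h (fun q : 'rV[R]_2 => c * q 0 i) (c * h 0 i).
  apply: (@is_deriveZ _ _ _ (fun q : 'rV[R]_2 => q 0 i) c p h (h 0 i)).
  exact: is_derive_coord.
have H := is_deriveD (d 0 a) (d 1 b).
by rewrite -[RHS](@derive_val _ _ _ _ _ _ _ H).
Qed.

Lemma differentiable_eps2 F p (a b : R) :
  (forall e : R, 0 < e -> \forall h \near (0 : 'rV[R]_2), `|F (h + p) - (F p + lin2 a b h)| <= e * `|h|) ->
  differentiable F p /\ forall v, 'D_v F p = lin2 a b v.
Proof.
move=> H; have [dl El] := lin2_diff a b 0.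
have [dF D] : differentiable F p /\ 'd F p = 'd (lin2 a b) 0 :> ('rV[R]_2 -> R).
  apply: differentiable_eps; first exact: diff_continuous dl.
  by move=> e e0; apply: filterS (H e e0) => h; rewrite El.
split; first exact: dF.
move=> v.
rewrite [LHS](deriveE v dF).
transitivity ('d (lin2 a b) 0 v); last exact: El.
by move/(congr1 (fun G => G v)): D.
Qed.

End Inverse.

(** * Local inversion by contraction, and smoothness of the inverse *)

Section Inverse2.
Variable R : realType.
Implicit Types (V U W : set 'rV[R]_2) (F G H : 'rV[R]_2 -> R).
Notation e1 := (pt (1 : R) 0).
Notation e2 := (pt (0 : R) 1).
Notation map2 F1 F2 := (fun p : 'rV[R]_2 => pt (F1 p) (F2 p)).

Lemma near_norm (p0 : 'rV[R]_2) (P : 'rV[R]_2 -> Prop) : (\forall p \near p0, P p) ->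
  exists2 r, 0 < r & forall p, `|p - p0| < r -> P p.
Proof.
move=> /nbhs_ballP [r /= r0 Hr]; exists r => // p pr; apply: Hr.
by rewrite -ball_normE /ball_ /= distrC.
Qed.

Lemma open_norm (p0 : 'rV[R]_2) (r : R) : open [set p | `|p - p0| < r].
Proof.
have -> : [set p | `|p - p0| < r] = ball p0 r.
  by apply/seteqP; split => p; rewrite -ball_normE /ball_ /= distrC.
have [r0|r0] := ltP 0 r; first exact: ball_open.
have -> : ball p0 r = set0; last exact: open0.
apply/seteqP; split => p //; rewrite -ball_normE /ball_ /= => H.
by have := le_lt_trans (normr_ge0 _) (lt_le_trans H r0); rewrite ltxx.
Qed.

Lemma near0_norm (e : R) : 0 < e -> \forall h \near (0 : 'rV[R]_2), `|h| < e.
Proof.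
move=> e0; have H0 : [set p : 'rV[R]_2 | `|p - 0| < e] 0 by rewrite /= subrr normr0.
apply: filterS (open_nbhs_nbhs (conj (@open_norm 0 e) H0)) => h /=.
by rewrite subr0.
Qed.

Lemma fixed_point2 (T : 'rV[R]_2 -> 'rV[R]_2) (p0 : 'rV[R]_2) (r : R) : 0 <= r ->
  (forall p, `|p - p0| <= r -> `|T p - p0| <= r) ->
  (forall p q, `|p - p0| <= r -> `|q - p0| <= r -> `|T p - T q| <= 2^-1 * `|p - q|) ->
  exists2 p, `|p - p0| <= r & T p = p.
Proof.
move=> r0 TB TL; pose B := [set p : 'rV[R]_2 | `|p - p0| <= r].
have fB : {homo T : x / B x >-> B x} by move=> p; exact: TB.
pose Tf := [fun of mkfun fB] : {fun B >-> B}.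
have [|||p Bp E] := @banach_fixed_point R 'rV[R]_2 B Tf.
- have h : 0 <= 2^-1 :> R by [].
  exists (NngNum h); split => /=; first by rewrite invf_lt1 ?ltr1n.
  by move=> [p q] [/= Bp Bq]; exact: TL.
- have -> : B = closed_ball_ (fun x => `|x|) p0 r.
    by apply/seteqP; split => p; rewrite /B /closed_ball_ /= distrC.
  exact: closed_closed_ball_.
- by exists p0; rewrite /B /= subrr normr0.
by exists p => //; rewrite [RHS]E.
Qed.

Definition jac F1 F2 p := 'D_e1 F1 p * 'D_e2 F2 p - 'D_e2 F1 p * 'D_e1 F2 p.

Lemma Ck_near V k F p : open V -> V p -> Ck k V F -> F y @[y --> p] --> F p.
Proof. by move=> oV Vp CF; exact: Ck_cont CF _ Vp. Qed.

Lemma smooth_D V F v : smooth V F -> smooth V ('D_v F).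
Proof. by move=> sF k; have [_ /(_ v)] := sF k.+1. Qed.

Lemma smooth_jac V F1 F2 : open V -> smooth V F1 -> smooth V F2 -> smooth V (jac F1 F2).
Proof.
move=> oV s1 s2 k; apply: CkB => //; apply: CkM => //.
- exact: (smooth_D e1 s1 k).
- exact: (smooth_D e2 s2 k).
- exact: (smooth_D e2 s1 k).
- exact: (smooth_D e1 s2 k).
Qed.

(* [a] is the inverse of the Jacobian matrix at [p0], so that [id - a o F] has zero differential there. *)
Lemma almost_id V F1 F2 p0 : open V -> V p0 -> smooth V F1 -> smooth V F2 -> jac F1 F2 p0 != 0 ->
  exists a11 a12 a21 a22 : R, exists2 r : R, 0 < r & a11 * a22 - a12 * a21 != 0 /\ forall p : 'rV[R]_2, `|p - p0| < r ->
  [/\ V p, jac F1 F2 p != 0 &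
      forall q : 'rV[R]_2, `|q - p0| < r ->
      let h x := pt (a11 * F1 x + a12 * F2 x) (a21 * F1 x + a22 * F2 x) in
      `|(p - h p) - (q - h q)| <= 2^-1 * `|p - q|].
Proof.
move=> oV V0 s1 s2 J0; set J := jac F1 F2 p0.
exists ('D_e2 F2 p0 / J), (- 'D_e2 F1 p0 / J), (- 'D_e1 F2 p0 / J), ('D_e1 F1 p0 / J).
set a11 := 'D_e2 F2 p0 / J; set a12 := - 'D_e2 F1 p0 / J.
set a21 := - 'D_e1 F2 p0 / J; set a22 := 'D_e1 F1 p0 / J.
pose H1 (p : 'rV[R]_2) := p 0 0 - (a11 * F1 p + a12 * F2 p).
pose H2 (p : 'rV[R]_2) := p 0 1 - (a21 * F1 p + a22 * F2 p).
have sH (i : 'I_2) (b c : R) : smooth V (fun p : 'rV[R]_2 => p 0 i - (b * F1 p + c * F2 p)).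
  by move=> k; apply: CkB => //; [exact: Ck_coord|apply: CkD => //; apply: CkZ].
have dH (i : 'I_2) (b c : R) v : 'D_v (fun p : 'rV[R]_2 => p 0 i - (b * F1 p + c * F2 p)) p0 =
    v 0 i - (b * 'D_v F1 p0 + c * 'D_v F2 p0).
  have [d1 _] := s1 1%N; have [d2 _] := s2 1%N.
  have h1 := derivableP (@diff_derivable _ _ _ F1 p0 v (d1 _ V0)).
  have h2 := derivableP (@diff_derivable _ _ _ F2 p0 v (d2 _ V0)).
  have h0 := is_derive_coord i p0 v.
  have h := is_deriveB h0 (is_deriveD (@is_deriveZ _ _ _ F1 b p0 v _ h1)
    (@is_deriveZ _ _ _ F2 c p0 v _ h2)).
  exact: (@derive_val _ _ _ _ _ _ _ h).
(* The bound [1/4] on the partial derivatives becomes the contraction ratio [1/2] through the factor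
   2 of [mvt2]. *)
have n4 F : smooth V F -> F p0 = 0 -> \forall p \near p0, `|F p| <= 4^-1.
  move=> sF F0; have /cvgrPdist_lt H := Ck_near oV V0 (sF 0%N).
  apply: filterS (H 4^-1 _); last by rewrite invr_gt0.
  by move=> p; rewrite F0 sub0r normrN => /ltW.
have NJ : \forall p \near p0, jac F1 F2 p != 0.
  have /cvgrPdist_lt H := Ck_near oV V0 (smooth_jac oV s1 s2 0%N).
  apply: filterS (H `|J| _); last by rewrite normr_gt0.
  by move=> p; apply: contraTneq => ->; rewrite subr0 ltxx.
have [Z1 Z2 Z3 Z4] : [/\ 'D_e1 H1 p0 = 0, 'D_e2 H1 p0 = 0, 'D_e1 H2 p0 = 0 & 'D_e2 H2 p0 = 0].
  rewrite !dH !pt0 !pt1 /a11 /a12 /a21 /a22.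
  move: J0; rewrite /J /jac.
  move: ('D_e1 F1 p0) ('D_e2 F2 p0) ('D_e2 F1 p0) ('D_e1 F2 p0) => A B C D J0.
  by split; field.
have M1 := n4 _ (smooth_D e1 (sH 0 a11 a12)) Z1.
have M2 := n4 _ (smooth_D e2 (sH 0 a11 a12)) Z2.
have M3 := n4 _ (smooth_D e1 (sH 1 a21 a22)) Z3.
have M4 := n4 _ (smooth_D e2 (sH 1 a21 a22)) Z4.
have NV : \forall p \near p0, V p by exact: open_nbhs_nbhs.
have [r r0 Hr] := near_norm (filterI NV (filterI NJ (filterI (filterI M1 M2) (filterI M3 M4)))).
exists r => //; split.
  rewrite /a11 /a12 /a21 /a22; move: J0; rewrite /J /jac.
  move: ('D_e1 F1 p0) ('D_e2 F2 p0) ('D_e2 F1 p0) ('D_e1 F2 p0) => A B C D J0.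
  have -> : B / (A * B - C * D) * (A / (A * B - C * D)) - - C / (A * B - C * D) * (- D / (A * B - C * D)) =
    (A * B - C * D)^-1 by field.
  by rewrite invr_neq0.
move=> p pr; have [Vp [Jp _]] := Hr p pr.
split; [exact: Vp|exact: Jp|move=> q qr].
pose h x := pt (a11 * F1 x + a12 * F2 x) (a21 * F1 x + a22 * F2 x).
change (`|p - h p - (q - h q)| <= 2^-1 * `|p - q|).
have L1 : `|H1 p - H1 q| <= 2 * 4^-1 * `|p - q|.
  have [d _] := sH 0 a11 a12 1%N.
  have b1 (x : 'rV[R]_2) : `|x - p0| < r -> differentiable H1 x by move=> /Hr[Vx _]; exact: d.
  have b2 (x : 'rV[R]_2) : `|x - p0| < r -> `|'D_e1 H1 x| <= 4^-1 /\ `|'D_e2 H1 x| <= 4^-1.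
    by move=> /Hr[_ [_ [H _]]].
  exact: (mvt2 b1 b2 pr qr).
have L2 : `|H2 p - H2 q| <= 2 * 4^-1 * `|p - q|.
  have [d _] := sH 1 a21 a22 1%N.
  have b1 (x : 'rV[R]_2) : `|x - p0| < r -> differentiable H2 x by move=> /Hr[Vx _]; exact: d.
  have b2 (x : 'rV[R]_2) : `|x - p0| < r -> `|'D_e1 H2 x| <= 4^-1 /\ `|'D_e2 H2 x| <= 4^-1.
    by move=> /Hr[_ [_ [_ H]]].
  exact: (mvt2 b1 b2 pr qr).
have E4 : 2 * 4^-1 = 2^-1 :> R by field.
rewrite E4 in L1 L2; rewrite norm_le2; apply/andP; split.
  by apply: le_trans L1; rewrite !mxE /= /H1.
by apply: le_trans L2; rewrite !mxE /= /H2.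
Qed.

(** To solve [Phi p = z], iterate [p + a (z - Phi p)] with the constant matrix [a] of [almost_id].
    The same contraction estimate gives uniqueness and a Lipschitz inverse, which is then
    differentiated directly from the definition. *)
Lemma inverse_map2 V F1 F2 p0 : open V -> V p0 -> smooth V F1 -> smooth V F2 ->
  jac F1 F2 p0 != 0 ->
  exists U W G1 G2, [/\ open U, open W, U p0, U `<=` V &
   [/\ smooth W G1, smooth W G2,
       forall p, U p -> W (map2 F1 F2 p) /\ map2 G1 G2 (map2 F1 F2 p) = p &
       forall z, W z -> U (map2 G1 G2 z) /\ map2 F1 F2 (map2 G1 G2 z) = z]].
Proof.
move=> oV V0 s1 s2 J0.
have [a11 [a12 [a21 [a22 [r r0 [det0 Hr]]]]]] := almost_id oV V0 s1 s2 J0.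
pose Phi p := pt (F1 p) (F2 p); pose z0 := Phi p0.
pose a (z : 'rV[R]_2) := pt (a11 * z 0 0 + a12 * z 0 1) (a21 * z 0 0 + a22 * z 0 1).
have aB z z' : a (z - z') = a z - a z'.
  by apply/rowP => i; rewrite !mxE; case: ifP => _; ring.
have HL p q : `|p - p0| < r -> `|q - p0| < r ->
    `|(p - a (Phi p)) - (q - a (Phi q))| <= 2^-1 * `|p - q|.
  by move=> /Hr[_ _ H] /H; rewrite /a /Phi !pt0 !pt1.
(* Split [p - q] into the difference of the values of [id - a o Phi], at most half as long, and
   [a (Phi p - Phi q)]. Injectivity and the Lipschitz bound on the inverse both come from here. *)
have lower p q : `|p - p0| < r -> `|q - p0| < r -> `|p - q| <= 2 * `|a (Phi p - Phi q)|.
  move=> pr qr; have := HL p q pr qr; rewrite aB.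
  set x := a _; set y := a _.
  have := ler_normD (p - x - (q - y)) (x - y).
  have -> : p - x - (q - y) + (x - y) = p - q by rewrite opprB addrA addrACA; apply/rowP => i; rewrite !mxE; ring.
  by lra.
(* The closed ball of radius [rho] lies in the open ball where the estimates hold. It is preserved
   by the iteration: [rho / 2] from the contraction plus [rho / 2] from the size of [W]. *)
pose rho := r / 2; have rho0 : 0 < rho by rewrite divr_gt0.
have rhor : rho < r by rewrite /rho; lra.
pose W := [set z | `|a (z - z0)| < rho / 2].
pose U := [set p | `|p - p0| < rho /\ W (Phi p)].
have ca : continuous a.
  move=> z; apply: differentiable_continuous; apply: (proj1 (diff_pt _ _)).
    exact: (proj1 (lin2_diff a11 a12 z)).
  exact: (proj1 (lin2_diff a21 a22 z)).
have oW : open W.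
  apply: (@open_comp _ _ (fun z => `|a (z - z0)|) [set x | x < rho / 2]); last exact: open_lt.
  move=> z _; apply: (@continuous_comp _ _ _ (fun z => a (z - z0))); last exact: norm_continuous.
  apply: (@continuous_comp _ _ _ (fun z => z - z0)); last exact: ca.
  by apply: continuousB; [exact: cvg_id|exact: cst_continuous].
have VB p : `|p - p0| < r -> V p by move=> /Hr[].
have cPhi p : `|p - p0| < r -> {for p, continuous Phi}.
  move=> /VB Vp; apply: differentiable_continuous; apply: (proj1 (diff_pt _ _)).
    by have [d _] := s1 1%N; exact: d.
  by have [d _] := s2 1%N; exact: d.
have oU : open U.
  rewrite openE => p [pr Wp]; apply: filterI.
    by apply: open_nbhs_nbhs; split => //; exact: open_norm.
  by apply: (cPhi p (lt_trans pr rhor)); exact: open_nbhs_nbhs.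
have sol z : W z -> exists p, U p /\ Phi p = z.
  move=> Wz; pose T p := p + a (z - Phi p).
  have TE p : T p = (p - a (Phi p)) + a z by rewrite /T aB addrA addrAC.
  have [||p pr E] := @fixed_point2 T p0 rho (ltW rho0).
  - move=> p pr; have -> : T p - p0 = ((p - a (Phi p)) - (p0 - a z0)) + a (z - z0).
      by rewrite TE aB; apply/rowP => i; rewrite !mxE; ring.
    apply: (le_trans (ler_normD _ _)); have H := HL p p0 (le_lt_trans pr rhor).
    rewrite subrr normr0 in H; have {}H := H r0; rewrite /W /= in Wz.
    by rewrite -/z0 in H; lra.
  - move=> p q pr qr; have -> : T p - T q = (p - a (Phi p)) - (q - a (Phi q)) by rewrite !TE; apply/rowP => i; rewrite !mxE; ring.
    exact: HL (le_lt_trans pr rhor) (le_lt_trans qr rhor).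
  have Ep : Phi p = z.
    have : a (z - Phi p) = 0 by apply: (addrI p); rewrite addr0.
    set v := z - Phi p => av.
    have av0 : a11 * v 0 0 + a12 * v 0 1 = 0 by rewrite -[LHS](pt0 _ (a21 * v 0 0 + a22 * v 0 1)) -/(a v) av mxE.
    have av1 : a21 * v 0 0 + a22 * v 0 1 = 0 by rewrite -[LHS](pt1 (a11 * v 0 0 + a12 * v 0 1)) -/(a v) av mxE.
    have v0 : v 0 0 = 0.
      apply: (mulfI det0); rewrite mulr0.
      have -> : (a11 * a22 - a12 * a21) * v 0 0 = a22 * (a11 * v 0 0 + a12 * v 0 1) - a12 * (a21 * v 0 0 + a22 * v 0 1) by ring.
      by rewrite av0 av1 !mulr0 subrr.
    have v1 : v 0 1 = 0.
      apply: (mulfI det0); rewrite mulr0.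
      have -> : (a11 * a22 - a12 * a21) * v 0 1 = a11 * (a21 * v 0 0 + a22 * v 0 1) - a21 * (a11 * v 0 0 + a12 * v 0 1) by ring.
      by rewrite av0 av1 !mulr0 subrr.
    apply/esym/eqP; rewrite -subr_eq0 -/v -(ptK v) v0 v1; apply/eqP/rowP => i.
    by rewrite !mxE if_same.
  exists p; split=> //; split; last by rewrite Ep.
  (* The fixed point theorem only places [p] in the closed ball; [lower] with [q = p0] makes the
     inequality strict, as [U] requires. *)
  have pr' := le_lt_trans pr rhor.
  have H := lower p p0 pr' _; rewrite subrr normr0 in H; have {}H := H r0.
  by rewrite Ep -/z0 in H; rewrite /W /= in Wz; lra.
have [g Hg] : exists g, forall z, W z -> U (g z) /\ Phi (g z) = z.
  have /choice[g Hg] : forall z, exists p, W z -> U p /\ Phi p = z.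
    by move=> z; have [/sol [p Hp]|nW] := pselect (W z); [exists p|exists p0].
  by exists g.
have gr z : W z -> `|g z - p0| < r by move=> /Hg[[H _] _]; exact: lt_trans rhor.
have ginj p : U p -> g (Phi p) = p.
  move=> [pr Wp]; have [_ E] := Hg _ Wp.
  have := lower _ _ (gr _ Wp) (lt_trans pr rhor).
  rewrite E subrr; have -> : a 0 = 0 by have := aB 0 0; rewrite !subrr.
  by rewrite normr0 mulr0 normr_le0 subr_eq0 => /eqP.
pose K := 2 * (`|a11| + `|a12| + `|a21| + `|a22|).
have K0 : 0 <= K by rewrite mulr_ge0 // !addr_ge0.
have gLip z z' : W z -> W z' -> `|g z - g z'| <= K * `|z - z'|.
  move=> Wz Wz'; have [_ E] := Hg _ Wz; have [_ E'] := Hg _ Wz'.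
  apply: (le_trans (lower _ _ (gr _ Wz) (gr _ Wz'))); rewrite E E' /K -mulrA ler_wpM2l //.
  have [N1 N2] := norm_coord (z - z'); move: N1 N2; set v := z - z' => N1 N2.
  have Q (b c : R) : `|b * v 0 0 + c * v 0 1| <= (`|b| + `|c|) * `|v|.
    apply: (le_trans (ler_normD _ _)); rewrite !normrM mulrDl lerD // ler_wpM2l //.
  have vp : 0 <= `|v| by [].
  rewrite norm_le2 pt0 pt1; apply/andP; split; [apply: (le_trans (Q _ _))|apply: (le_trans (Q _ _))];
    rewrite ler_wpM2r //.
    by rewrite -addrA lerDl addr_ge0.
  by rewrite -!addrA [leRHS]addrA lerDr addr_ge0.
have nW z : W z -> \forall h \near (0 : 'rV[R]_2), W (h + z).
  move=> Wz; have : \forall y \near z, W y by exact: open_nbhs_nbhs.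
  by rewrite (near_shift 0 z) subr0.
(* [(c1, c2)] is row [i] of the inverse Jacobian matrix at [g z]. The linearisation errors of [F1]
   and [F2] are small against [|k|], hence against [|h|] because [|k| <= K |h|]. *)
have dG (i : 'I_2) z (c1 c2 : R) : W z ->
   (forall k : 'rV[R]_2, c1 * 'D_k F1 (g z) + c2 * 'D_k F2 (g z) = k 0 i) ->
   differentiable (fun z => g z 0 i) z /\ forall v, 'D_v (fun z => g z 0 i) z = lin2 c1 c2 v.
  move=> Wz Hc; apply: differentiable_eps2 => e e0.
  have Vp := VB _ (gr _ Wz).
  have d1 : differentiable F1 (g z) by have [d _] := s1 1%N; exact: d.
  have d2 : differentiable F2 (g z) by have [d _] := s2 1%N; exact: d.
  pose M := (`|c1| + `|c2| + 1) * (K + 1).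
  have M0 : 0 < M by rewrite mulr_gt0 // ltr_wpDl // addr_ge0.
  pose eta := e / M; have eta0 : 0 < eta by rewrite divr_gt0.
  have [x1 x10 Hx1] := near_norm (filterI (diff_eps d1 eta0) (diff_eps d2 eta0)).
  have Hn : \forall h \near (0 : 'rV[R]_2), `|h| < x1 / (K + 1).
    by apply: near0_norm; rewrite divr_gt0 // ltr_wpDl.
  apply: filterS (filterI (nW z Wz) Hn) => h [Wh hx].
  set k := g (h + z) - g z.
  have kh : `|k| <= K * `|h|.
    by have := gLip _ _ Wh Wz; rewrite addrK.
  have kx : `|k - 0| < x1.
    rewrite subr0; apply: (le_lt_trans kh); apply: (@le_lt_trans _ _ ((K + 1) * `|h|)).
      by rewrite ler_wpM2r // lerDl.
    by rewrite mulrC -ltr_pdivlMr // ltr_wpDl.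
  have [R1 R2] := Hx1 k kx.
  have kg : k + g z = g (h + z) by rewrite /k subrK.
  have [_ E] := Hg _ Wh; have [_ E'] := Hg _ Wz.
  have h0 : h 0 0 = F1 (k + g z) - F1 (g z).
    by rewrite kg -[F1 (g (h + z))](pt0 _ (F2 (g (h + z)))) -/(Phi (g (h + z))) E -[F1 (g z)](pt0 _ (F2 (g z))) -/(Phi (g z)) E' !mxE addrK.
  have h1 : h 0 1 = F2 (k + g z) - F2 (g z).
    by rewrite kg -[F2 (g (h + z))](pt1 (F1 (g (h + z)))) -/(Phi (g (h + z))) E -[F2 (g z)](pt1 (F1 (g z))) -/(Phi (g z)) E' !mxE addrK.
  have kE : g (h + z) 0 i = g z 0 i + k 0 i by rewrite /k !mxE; ring.
  rewrite -(deriveE k d1) in R1; rewrite -(deriveE k d2) in R2.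
  rewrite /lin2 h0 h1 kE -(Hc k).
  move: R1 R2; move: ('D_k F1 (g z)) ('D_k F2 (g z)) (F1 (k + g z)) (F2 (k + g z)) (F1 (g z)) (F2 (g z)).
  move=> D1 D2 f1 f2 f1' f2' R1 R2.
  have -> : g z 0 i + (c1 * D1 + c2 * D2) - (g z 0 i + (c1 * (f1 - f1') + c2 * (f2 - f2'))) =
    - (c1 * (f1 - (f1' + D1)) + c2 * (f2 - (f2' + D2))) by ring.
  rewrite normrN; apply: (le_trans (ler_normD _ _)); rewrite !normrM.
  apply: (@le_trans _ _ ((`|c1| + `|c2|) * (eta * (K * `|h|)))).
    rewrite mulrDl lerD // ler_wpM2l //; apply: (le_trans _ (ler_wpM2l (ltW eta0) kh)) => //.
  have Ee : e = eta * M by rewrite /eta divfK // gt_eqF.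
  have -> : e * `|h| = (`|c1| + `|c2| + 1) * (eta * ((K + 1) * `|h|)).
    by rewrite [in LHS]Ee /M; ring.
  have eta1 := ltW eta0.
  apply: ler_pM; [exact: addr_ge0|exact: mulr_ge0 eta1 (mulr_ge0 K0 (normr_ge0 _))|by rewrite lerDl|].
  by rewrite ler_wpM2l // ler_wpM2r // lerDl.
pose B := [set p : 'rV[R]_2 | `|p - p0| < r].
have oB : open B by exact: open_norm.
have BV : B `<=` V by move=> p; exact: VB.
have J1 p : B p -> jac F1 F2 p != 0 by move=> /Hr[].
have dF p v : B p -> 'D_v F1 p = v 0 0 * 'D_e1 F1 p + v 0 1 * 'D_e2 F1 p /\
    'D_v F2 p = v 0 0 * 'D_e1 F2 p + v 0 1 * 'D_e2 F2 p.
  by move=> /VB Vp; split; apply: deriveE2; [have [d _] := s1 1%N|have [d _] := s2 1%N]; exact: d.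
have dG1 z : W z -> differentiable (fun z => g z 0 0) z /\
    forall v, 'D_v (fun z => g z 0 0) z = lin2 ('D_e2 F2 (g z) / jac F1 F2 (g z))
      (- 'D_e2 F1 (g z) / jac F1 F2 (g z)) v.
  move=> Wz; apply: dG => // k; have [-> ->] := dF _ k (gr _ Wz).
  have := J1 _ (gr _ Wz); rewrite /jac.
  move: ('D_e1 F1 (g z)) ('D_e2 F1 (g z)) ('D_e1 F2 (g z)) ('D_e2 F2 (g z)) => x1 x2 x3 x4 Jx.
  by field.
have dG2 z : W z -> differentiable (fun z => g z 0 1) z /\
    forall v, 'D_v (fun z => g z 0 1) z = lin2 (- 'D_e1 F2 (g z) / jac F1 F2 (g z))
      ('D_e1 F1 (g z) / jac F1 F2 (g z)) v.
  move=> Wz; apply: dG => // k; have [-> ->] := dF _ k (gr _ Wz).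
  have := J1 _ (gr _ Wz); rewrite /jac.
  move: ('D_e1 F1 (g z)) ('D_e2 F1 (g z)) ('D_e1 F2 (g z)) ('D_e2 F2 (g z)) => x1 x2 x3 x4 Jx.
  by field.
have CJ k : Ck k B (fun p => (jac F1 F2 p)^-1).
  by apply: CkV => //; apply: CkS BV _; exact: smooth_jac.
have CD k F v : smooth V F -> Ck k B ('D_v F) by move=> sF; apply: CkS BV _; exact: smooth_D.
have CL k (P Q : 'rV[R]_2 -> R) (v : 'rV[R]_2) : Ck k B P -> Ck k B Q ->
    Ck k B (fun p => lin2 (P p * (jac F1 F2 p)^-1) (Q p * (jac F1 F2 p)^-1) v).
  move=> CP CQ; apply: CkD => //; (apply: CkM => //; last exact: Ck_cst); exact: CkM.
(* Bootstrap: the derivatives of [g] are smooth functions composed with [g], so class [k] for [g]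
   gives class [k] for its derivatives, that is, class [k + 1] for [g]. *)
have CG k : Ck k W (fun z => g z 0 0) /\ Ck k W (fun z => g z 0 1).
  elim: k => [|k [IH1 IH2]].
    by split=> z Wz; apply: differentiable_continuous; [exact: (proj1 (dG1 z Wz))|exact: (proj1 (dG2 z Wz))].
  have gB z : W z -> B (pt (g z 0 0) (g z 0 1)) by rewrite ptK; exact: gr.
  split; (split=> [z Wz|v]; first by [exact: (proj1 (dG1 z Wz))|exact: (proj1 (dG2 z Wz))]).
    have H := @Ck_comp2 _ _ k W B _ _ _ oW gB
      (CL k _ _ v (CD k F2 e2 s2) (CkN oB (CD k F1 e2 s1))) IH1 IH2.
    by apply: Ck_eq H => // z Wz; rewrite ptK (proj2 (dG1 z Wz)).
  have H := @Ck_comp2 _ _ k W B _ _ _ oW gB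
      (CL k _ _ v (CkN oB (CD k F2 e1 s2)) (CD k F1 e1 s1)) IH1 IH2.
  by apply: Ck_eq H => // z Wz; rewrite ptK (proj2 (dG2 z Wz)).
exists U, W, (fun z => g z 0 0), (fun z => g z 0 1); split=> //.
- split; first by rewrite subrr normr0.
  rewrite /W /=; have -> : a (Phi p0 - z0) = 0 by rewrite aB subrr.
  by rewrite normr0 divr_gt0.
- by move=> p [pr _]; apply: VB; exact: lt_trans rhor.
split.
- by move=> k; have [] := CG k.
- by move=> k; have [] := CG k.
- by move=> p Up; rewrite ptK; split; [case: Up|exact: ginj].
- by move=> z /Hg; rewrite ptK.
Qed.

End Inverse2.

(** * Comparison with [smooth_on] *)

Section Bridge.
Variable R : realType.
Implicit Types V : normedModType R.
Notation e1 := (pt (1 : R) 0).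
Notation e2 := (pt (0 : R) 1).

(** In [iderive] the head of the list is the outermost derivative, while [Ck] peels off the
    innermost one; appending at the end translates between the two. *)
Lemma iderive_rcons V (W : normedModType R) vs v (f : V -> W) :
  iderive (rcons vs v) f = iderive vs (fun x => 'D_v f x).
Proof. by elim: vs => [//|w vs IH]; rewrite /= IH. Qed.

Lemma smooth_on_derive V (U : set V) (f : V -> R) v : smooth_on U f -> smooth_on U ('D_v f).
Proof. by move=> sf vs x Ux; have := sf (rcons vs v) x Ux; rewrite iderive_rcons. Qed.

(** [smooth_on] provides directional derivatives where [Ck] asks for differentials. The passage is
    kept as a hypothesis because its proof depends on the dimension: immediate on the line,
    [differentiable_of_on] in the plane. *)
Lemma smooth_of_on V (U : set V) :
  (forall f : V -> R, smooth_on U f -> forall x, U x -> differentiable f x) ->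
  forall f : V -> R, smooth_on U f -> smooth U f.
Proof.
move=> H f sf k; elim: k f sf => [|k IH] f sf.
  by move=> x Ux; have [] := sf [::] x Ux.
split; first exact: H.
by move=> v; apply: IH; exact: smooth_on_derive.
Qed.

Lemma smooth_of_on1 (U : set R) (f : R -> R) : smooth_on U f -> smooth U f.
Proof.
apply: smooth_of_on => {}f sf x Ux; apply/derivable1_diffP.
by have [_] := sf [::] x Ux; apply.
Qed.

Lemma is_derive_line V (f : V -> R) (q v : V) (t : R) : derivable f (t *: v + q) v ->
  is_derive t 1 (fun s : R => f (s *: v + q)) ('D_v f (t *: v + q)).
Proof.
move=> df; have E : (fun h : R => h^-1 *: (f (h *: v + (t *: v + q)) - f (t *: v + q))) =
   (fun h : R => h^-1 *: (f ((h *: (1 : R) + t) *: v + q) - f (t *: v + q))).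
  by apply/funext => h; rewrite [h *: 1]mulr1 scalerDl addrA.
by apply: DeriveDef; [move: df; rewrite /derivable E|rewrite /derive E].
Qed.

(** Scaling to [t] in [[0, 1]] avoids a case distinction on the sign of [c]. *)
Lemma mvt_line V (f : V -> R) (q v : V) (c : R) :
  (forall t : R, 0 <= t <= 1 -> derivable f ((c * t) *: v + q) v) ->
  exists2 t : R, 0 <= t <= 1 & f (c *: v + q) - f q = 'D_v f ((c * t) *: v + q) * c.
Proof.
move=> df; pose g t := f ((c * t) *: v + q).
have dg (t : R) : 0 <= t <= 1 -> is_derive t 1 g ('D_v f ((c * t) *: v + q) * c).
  move=> /df /is_derive_line H.
  have hc : is_derive t 1 (fun s : R => c * s) c.
    by have := @is_deriveZ _ _ _ id c t 1 1 (is_derive_id _ _); rewrite /GRing.scale /= mulr1.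
  exact: (is_derive_comp1 hc H).
have [||t] := @MVT R g (fun t => 'D_v f ((c * t) *: v + q) * c) 0 1 ltr01.
- by move=> t; rewrite in_itv /= => /andP[/ltW t0 /ltW t1]; apply: dg; rewrite t0.
- apply: continuous_in_subspaceT => t; rewrite inE /= in_itv /= => t01.
  exact: (differentiable_continuous (is_derive_differentiable (dg t t01))).
rewrite in_itv /= => /andP[/ltW t0 /ltW t1]; rewrite /g mulr1 mulr0 scale0r add0r subr0 mulr1.
by move=> E; exists t => //; rewrite t0.
Qed.

(** Continuous partial derivatives suffice: go from [p] to [p + h] along [e1], then along [e2], and
    apply the mean value theorem on each leg, where the partial derivatives stay within [e / 2] of
    their values at [p]. *)
Lemma differentiable_of_on (U : set 'rV[R]_2) (f : 'rV[R]_2 -> R) : open U -> smooth_on U f ->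
  forall p, U p -> differentiable f p.
Proof.
move=> oU sf p Up; suff [] : differentiable f p /\
  forall v, 'D_v f p = lin2 ('D_e1 f p) ('D_e2 f p) v by [].
apply: differentiable_eps2 => e e0.
have c (v : 'rV[R]_2) : \forall q \near p, `|'D_v f q - 'D_v f p| < e / 2.
  have [cv _] := sf [:: v] p Up.
  have /cvgrPdist_lt /(_ _ (divr_gt0 e0 (ltr0Sn _ 1))) : 'D_v f q @[q --> p] --> 'D_v f p := cv.
  by apply: filterS => q; rewrite distrC.
have nU : \forall q \near p, U q by exact: open_nbhs_nbhs.
have [r r0 Hr] := near_norm (filterI nU (filterI (c e1) (c e2))).
apply: filterS (near0_norm r0) => h hr.
have [h0 h1] := norm_coord h.
have B (s t : R) : `|s| <= `|h 0 0| -> `|t| <= `|h 0 1| -> `|(t *: e2 + (s *: e1 + p)) - p| < r.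
  move=> s0 t0; apply: le_lt_trans hr; rewrite addrA addrK addrC -pt_lin norm_le2 pt0 pt1.
  by rewrite (le_trans s0 h0) (le_trans t0 h1).
have small (a t : R) : 0 <= t <= 1 -> `|a * t| <= `|a|.
  by move=> /andP[t0 t1]; rewrite normrM (ger0_norm t0) ler_piMr.
have n0 : `|0 : R| <= `|h 0 1| by rewrite normr0.
have [|t t01 Et] := @mvt_line _ f p e1 (h 0 0).
  move=> t t01; have [H _] := Hr _ (B (h 0 0 * t) 0 (small _ _ t01) n0).
  by rewrite scale0r add0r in H; have [_] := sf [::] _ H; apply.
have [|s s01 Es] := @mvt_line _ f (h 0 0 *: e1 + p) e2 (h 0 1).
  move=> s s01; have [H _] := Hr _ (B (h 0 0) (h 0 1 * s) (lexx _) (small _ _ s01)).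
  by have [_] := sf [::] _ H; apply.
have -> : h + p = h 0 1 *: e2 + (h 0 0 *: e1 + p) by rewrite -{1}(ptK h) pt_lin [_ + h 0 1 *: _]addrC -addrA.
have [_ [_ D2]] := Hr _ (B (h 0 0) (h 0 1 * s) (lexx _) (small _ _ s01)).
have := Hr _ (B (h 0 0 * t) 0 (small _ _ t01) n0); rewrite scale0r add0r => -[_ [D1 _]].
move: Et Es D1 D2; rewrite /lin2.
move: (f (h 0 1 *: e2 + (h 0 0 *: e1 + p))) (f (h 0 0 *: e1 + p)) (f p) => f2 f1 f0.
move: ('D_e1 f (h 0 0 * t *: _ + _)) ('D_e1 f p) => d1 d1'.
move: ('D_e2 f ((h 0 1 * s) *: _ + _)) ('D_e2 f p) => d2 d2' Et Es D1 D2.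
have -> : f2 - (f0 + (d1' * h 0 0 + d2' * h 0 1)) = (d1 - d1') * h 0 0 + (d2 - d2') * h 0 1.
  have -> : f2 = (f2 - f1) + (f1 - f0) + f0 by ring.
  by rewrite Es Et; ring.
apply: (le_trans (ler_normD _ _)); rewrite !normrM.
apply: (le_trans (lerD (ler_pM _ _ (ltW D1) h0) (ler_pM _ _ (ltW D2) h1))) => //.
by rewrite -mulrDl -splitr.
Qed.

Lemma smooth_of_on2 (U : set 'rV[R]_2) (f : 'rV[R]_2 -> R) : open U -> smooth_on U f -> smooth U f.
Proof. by move=> oU; apply: smooth_of_on => {}f; exact: differentiable_of_on. Qed.

Lemma iderive_coord V (U : set V) (f : V -> 'rV[R]_2) (i : 'I_2) vs : open U -> smooth_on U f ->
  forall x, U x -> iderive vs (fun x => f x 0 i : R) x = iderive vs f x 0 i.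
Proof.
move=> oU sf; elim: vs => [//|v vs IH] x Ux /=.
have [_ /(_ v) D] := sf vs x Ux.
rewrite (derive_mx D) mxE; apply: near_eq_derive; exact: (near_open oU IH).
Qed.

Lemma smooth_on_coord V (U : set V) (f : V -> 'rV[R]_2) (i : 'I_2) : open U -> smooth_on U f ->
  smooth_on U (fun x => f x 0 i : R).
Proof.
move=> oU sf vs x Ux; have [cf df] := sf vs x Ux.
have E := near_open oU (iderive_coord i vs oU sf) Ux; split.
  change (iderive vs (fun x => f x 0 i : R) y @[y --> x] --> iderive vs (fun x => f x 0 i : R) x).
  rewrite (iderive_coord i vs oU sf Ux).
  have H : iderive vs f y 0 i @[y --> x] --> iderive vs f x 0 i.
    by apply: (@continuous_comp _ _ _ (iderive vs f) (fun q : 'rV[R]_2 => q 0 i)) => //; exact: coord_continuous.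
  by apply: cvg_trans H; apply: near_eq_cvg; apply: filterS E => y ->.
move=> v; have D := (derivable_mxP _ _ _).1 (df v) 0 i.
by apply: near_eq_derivable D; apply: filterS E => y ->.
Qed.

Lemma Ck_iderive V (U : set V) (f : V -> R) vs k : Ck (size vs + k) U f -> Ck k U (iderive vs f).
Proof.
elim: vs k => [//|v vs IH] k /= Cf.
have [_ /(_ v)] : Ck k.+1 U (iderive vs f) by apply: IH; rewrite addnS.
by [].
Qed.

Lemma smooth_on_of V (U : set V) (f : V -> R) : smooth U f -> smooth_on U f.
Proof.
move=> sf vs x Ux; have [d _] := Ck_iderive (sf (size vs + 1)%N).
by split=> [|v]; [exact/differentiable_continuous/d|exact/diff_derivable/d].
Qed.

Lemma smooth_on_pt V (U : set V) (f g : V -> R) : open U -> smooth U f -> smooth U g ->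
  smooth_on U (fun x => pt (f x) (g x)).
Proof.
move=> oU sf sg.
have D vs x : U x -> differentiable (iderive vs f) x /\ differentiable (iderive vs g) x.
  have [d1 _] := Ck_iderive (sf (size vs + 1)%N); have [d2 _] := Ck_iderive (sg (size vs + 1)%N).
  by move=> Ux; split; [exact: d1|exact: d2].
have E vs x : U x -> iderive vs (fun x => pt (f x) (g x)) x = pt (iderive vs f x) (iderive vs g x).
  elim: vs x => [//|v vs IH] x Ux /=; have [d1 d2] := D vs x Ux.
  rewrite (near_eq_derive v (near_open oU IH Ux)).
  have [dp Ep] := diff_pt d1 d2.
  by rewrite (deriveE v dp) Ep -(deriveE v d1) -(deriveE v d2).
move=> vs x Ux; have [d1 d2] := D vs x Ux; have [dp _] := diff_pt d1 d2.
have dE : differentiable (iderive vs (fun x => pt (f x) (g x))) x.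
  by apply: differentiable_near dp; apply: (near_open oU) Ux => y Uy; rewrite E.
by split=> [|v]; [exact: differentiable_continuous|exact: diff_derivable].
Qed.

Lemma dn_iderive n (f : R -> R) : iderive (nseq n (1 : R)) f = dn n f.
Proof. by elim: n => [//|n IH]; apply/funext => x; rewrite dnS /= IH. Qed.

Lemma kder_coord (U : set R) (g : R -> 'rV[R]_2) (i : 'I_2) n t : open U -> smooth_on U g -> U t ->
  kder n g t 0 i = dn n (fun t => g t 0 i) t.
Proof. by move=> oU sg Ut; rewrite -dn_iderive (iderive_coord i _ oU sg Ut). Qed.

(** Apply the planar theorem to [(x, y) -> (f x, y)] and restrict to [y = 0]. *)
Lemma inverse_map1 (V : set R) (f : R -> R) (x0 : R) : open V -> V x0 -> smooth V f ->
  'D_1 f x0 != 0 ->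
  exists U W g, [/\ open U, open W, U x0, U `<=` V &
   [/\ smooth W g, forall x, U x -> W (f x) /\ g (f x) = x &
       forall z, W z -> U (g z) /\ f (g z) = z]].
Proof.
move=> oV V0 sf f0; pose V2 := [set p : 'rV[R]_2 | V (p 0 0)].
have oV2 : open V2 by apply: (@open_comp _ _ (fun p : 'rV[R]_2 => p 0 0)) => // p _; exact: coord_continuous.
pose F1 (p : 'rV[R]_2) := f (p 0 0); pose F2 (p : 'rV[R]_2) := p 0 1.
have s1 : smooth V2 F1.
  by move=> k; apply: (@Ck_comp1 _ _ _ V2 V) => //; exact: Ck_coord.
have s2 : smooth V2 F2 by move=> k; exact: Ck_coord.
have V20 : V2 (pt x0 0) by rewrite /V2 /= pt0.
have J : jac F1 F2 (pt x0 0) != 0.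
  rewrite /jac /F2 !derive_coord pt1 pt1 mulr1 mulr0 subr0.
  have [d _] := s1 1%N.
  have H := @is_derive_pt _ F1 id (fun=> 0) x0 1 0 (d _ V20) (is_derive_id _ _) (@is_derive_cst R R^o R^o 0 x0 1).
  have E : (fun s : R => F1 (pt (id s) 0)) = f by apply/funext => s; rewrite /F1 pt0.
  by move: H; rewrite E mulr1 mulr0 addr0 => H; rewrite -(@derive_val _ _ _ _ _ _ _ H).
have [U [W [G1 [G2 [oU oW U0 UV [g1 g2 HU HW]]]]]] := inverse_map2 oV2 V20 s1 s2 J.
have cpt (c : R) t : {for t, continuous (fun t : R => pt t c)}.
  apply: differentiable_continuous; apply: (proj1 (diff_pt _ _)).
    by apply/derivable1_diffP; exact: derivable_id.
  exact: differentiable_cst.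
have opt (A : set 'rV[R]_2) : open A -> open [set t | A (pt t 0)].
  by move=> oA; apply: (@open_comp _ _ (fun t : R => pt t 0)) => // t _; exact: cpt.
exists [set t | U (pt t 0)], [set t | W (pt t 0)], (fun t => G1 (pt t 0)); split=> //.
- exact: opt.
- exact: opt.
- by move=> t /= /UV; rewrite /V2 /= pt0.
have EF t : pt (F1 (pt t 0)) (F2 (pt t 0)) = pt (f t) 0 by rewrite /F1 /F2 pt0 pt1.
split.
- move=> k; apply: (@Ck_comp2 _ _ _ _ W G1 id (fun=> 0)) => //; first exact: opt.
    exact: Ck_id.
  exact: Ck_cst.
- move=> t /= /HU; rewrite EF => -[Wt E]; split=> //.
  by have := congr1 (fun q : 'rV[R]_2 => q 0 0) E; rewrite !pt0.
- move=> z /= /HW [Uz E].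
  have E0 := congr1 (fun q : 'rV[R]_2 => q 0 0) E.
  have E1 := congr1 (fun q : 'rV[R]_2 => q 0 1) E.
  rewrite /F1 /F2 !pt0 in E0; rewrite /F2 !pt1 in E1.
  by rewrite E1 in Uz; split.
Qed.

End Bridge.

(** * Jets of reparametrised curves *)

Section Jets.
Variable R : realType.
Implicit Types (f g : R -> R) (U : set R) (p q u : {poly R}).

Lemma Ot0_cst (c : R) : Ot 0 (fun=> c).
Proof. by apply: Ot_cont; exact: cst_continuous. Qed.

Lemma Ot0_id : Ot 0 (fun t : R => t).
Proof. exact: OtW (Ot_X R 1). Qed.

Lemma Ot0M f g : Ot 0 f -> Ot 0 g -> Ot 0 (fun t => f t * g t).
Proof. exact: (@OtM _ 0 0). Qed.

Lemma OtXM n m f : Ot m f -> Ot (n + m) (fun t => t ^+ n * f t).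
Proof. exact: OtM (Ot_X _ n). Qed.

Lemma Ot_zero n f : (forall t, f t = 0) -> Ot n f.
Proof.
by move=> f0; exists 0; apply: (@nearW _ (nbhs (0 : R))) => t; rewrite f0 normr0 mul0r.
Qed.

(** Four scalars instead of a polynomial: chaining [j4M] and [j4D] computes the symbolic
    coefficients of a product by unification. *)
Definition j4 f (a0 a1 a2 a3 : R) :=
  Ot 4 (fun t => f t - (a0 + a1 * t + a2 * t ^+ 2 + a3 * t ^+ 3)).

Lemma Ot0_cubic (a0 a1 a2 a3 : R) : Ot 0 (fun t => a0 + a1 * t + a2 * t ^+ 2 + a3 * t ^+ 3).
Proof.
do 3 (apply: OtD; last by apply: Ot0M; [exact: Ot0_cst|exact: Ot0_id || exact: OtW (leq0n _) (Ot_X R _)]).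
exact: Ot0_cst.
Qed.

Lemma j4_Ot0 f a0 a1 a2 a3 : j4 f a0 a1 a2 a3 -> Ot 0 f.
Proof.
move=> H; apply: Ot_eq (OtD (OtW (leq0n 4) H) (Ot0_cubic a0 a1 a2 a3)).
by apply: (@nearW _ (nbhs (0 : R))) => t; rewrite subrK.
Qed.

Lemma j4M f g a0 a1 a2 a3 b0 b1 b2 b3 : j4 f a0 a1 a2 a3 -> j4 g b0 b1 b2 b3 ->
  j4 (fun t => f t * g t) (a0 * b0) (a0 * b1 + a1 * b0) (a0 * b2 + a1 * b1 + a2 * b0)
    (a0 * b3 + a1 * b2 + a2 * b1 + a3 * b0).
Proof.
move=> Hf Hg.
have H1 := @OtM _ 0 4 _ _ (j4_Ot0 Hf) Hg.
have H2 := @OtM _ 0 4 _ _ (Ot0_cubic b0 b1 b2 b3) Hf.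
have H3 := OtXM 4 (Ot0_cubic (a1 * b3 + a2 * b2 + a3 * b1) (a2 * b3 + a3 * b2) (a3 * b3) 0).
apply: Ot_eq (OtD (OtD H1 H2) H3); apply: (@nearW _ (nbhs (0 : R))) => t.
by move: (f t) (g t) => x y; ring.
Qed.

Lemma j4D f g a0 a1 a2 a3 b0 b1 b2 b3 : j4 f a0 a1 a2 a3 -> j4 g b0 b1 b2 b3 ->
  j4 (fun t => f t + g t) (a0 + b0) (a1 + b1) (a2 + b2) (a3 + b3).
Proof.
move=> Hf Hg; apply: Ot_eq (OtD Hf Hg); apply: (@nearW _ (nbhs (0 : R))) => t.
by move: (f t) (g t) => x y; ring.
Qed.

Definition p47 (c0 c4 c5 c6 c7 : R) : {poly R} :=
  c0%:P + c4 *: 'X^4 + c5 *: 'X^5 + c6 *: 'X^6 + c7 *: 'X^7.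

Lemma horner_p47 c0 c4 c5 c6 c7 t :
  (p47 c0 c4 c5 c6 c7).[t] = c0 + t ^+ 4 * (c4 + c5 * t + c6 * t ^+ 2 + c7 * t ^+ 3).
Proof. by rewrite /p47 !hornerD hornerC !hornerZ !hornerXn; ring. Qed.

(* Only the jet of order 4 of [u] matters, because [f - f 0] has order 4. *)
Lemma tay_p47_comp f g u (c0 c4 c5 c6 c7 u0 u1 u2 u3 : R) :
  tay 8 f (p47 c0 c4 c5 c6 c7) -> tay 8 g ('X * u) -> j4 (horner u) u0 u1 u2 u3 ->
  tay 8 (fun t => f (g t)) (p47 c0 (c4 * u0 ^+ 4) (c4 * (4 * u0 ^+ 3 * u1) + c5 * u0 ^+ 5)
    (c4 * (4 * u0 ^+ 3 * u2 + 6 * u0 ^+ 2 * u1 ^+ 2) + c5 * (5 * u0 ^+ 4 * u1) + c6 * u0 ^+ 6)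
    (c4 * (4 * u0 ^+ 3 * u3 + 12 * u0 ^+ 2 * u1 * u2 + 4 * u0 * u1 ^+ 3)
     + c5 * (5 * u0 ^+ 4 * u2 + 10 * u0 ^+ 3 * u1 ^+ 2) + c6 * (6 * u0 ^+ 5 * u1) + c7 * u0 ^+ 7)).
Proof.
move=> Hf Hg Hu; have g1 : Ot 1 g.
  have H1 := OtM (Ot_X R 1) (Ot_horner u).
  have H2 : Ot 1 (fun t => g t - ('X * u).[t]) by exact: OtW Hg.
  by apply: Ot_eq (OtD H2 H1); apply: (@nearW _ (nbhs (0 : R))) => t; rewrite hornerM hornerX expr1 subrK.
have H := tay_comp Hf Hg g1.
have Hx : j4 (fun t : R => t) 0 1 0 0.
  by apply: Ot_zero => t; ring.
have c4' (c : R) : j4 (fun=> c) c 0 0 0.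
  by apply: Ot_zero => t; ring.
(* With [w = t u], the composition minus its constant term is
   [t^4 u^4 (c4 + c5 w + c6 w^2 + c7 w^3)] up to order 8; the cofactor of [t^4] is needed to order 4
   only. *)
have Hw := j4M Hx Hu; have Hw2 := j4M Hw Hw; have Hw3 := j4M Hw2 Hw.
have Hu2 := j4M Hu Hu; have Hu4 := j4M Hu2 Hu2.
have Hm := j4D (j4D (j4D (c4' c4) (j4M (c4' c5) Hw)) (j4M (c4' c6) Hw2)) (j4M (c4' c7) Hw3).
have HG := j4M Hu4 Hm.
have HO := OtXM 4 HG.
apply: Ot_eq (OtD H HO); apply: (@nearW _ (nbhs (0 : R))) => t.
rewrite horner_comp !horner_p47 hornerM hornerX.
move: (u.[t]) (f (g t)) => x y; ring.
Qed.

End Jets.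

(** * Taylor coefficients, and the reparametrisation that acts on the exponents 10 and 11 *)

Section Reparametrisation.
Variable R : realType.
Implicit Types (f g : R -> R) (U : set R) (p q u : {poly R}).

Lemma tay_horner_eq n f p q : (forall t, p.[t] = q.[t]) -> tay n f p -> tay n f q.
Proof. by move=> E; apply: Ot_eq; apply: (@nearW _ (nbhs (0 : R))) => t; rewrite E. Qed.

Definition tc f i : R := dn i f 0 / i`!%:R.

Lemma dn_tc f i : dn i f 0 = i`!%:R * tc f i.
Proof. by rewrite /tc mulrCA divff ?mulr1 // pnatr_eq0 -lt0n fact_gt0. Qed.

Lemma tc_tay U f n p i : open U -> U 0 -> smooth U f -> tay n f p -> (i < n)%N -> tc f i = p`_i.
Proof.
move=> oU U0 sf Hp ilt; rewrite /tc (dn_tay oU U0 sf Hp ilt) mulrAC divff ?mul1r //.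
Qed.

Lemma horner_tpoly n f t : (tpoly n f).[t] = \sum_(i < n) tc f i * t ^+ i.
Proof. by rewrite horner_poly. Qed.

Lemma taylor47 U f : open U -> U 0 -> smooth U f -> {in [:: 1; 2; 3]%N, forall i, tc f i = 0} ->
  tay 8 f (p47 (tc f 0) (tc f 4) (tc f 5) (tc f 6) (tc f 7)).
Proof.
move=> oU U0 sf f0; apply: tay_horner_eq (taylor 8 oU U0 sf) => t.
rewrite horner_tpoly horner_p47.
have f1 := f0 1%N isT; have f2 := f0 2%N isT; have f3 := f0 3%N isT.
move: (tc f) f1 f2 f3 => c f1 f2 f3.
by rewrite !big_ord_recr big_ord0 /= f1 f2 f3; ring.
Qed.

Lemma coef_p47 (c0 c4 c5 c6 c7 : R) : let p := p47 c0 c4 c5 c6 c7 in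
  [/\ p`_0 = c0, p`_1 = 0, p`_2 = 0 & p`_3 = 0] /\
  [/\ p`_4 = c4, p`_5 = c5, p`_6 = c6 & p`_7 = c7].
Proof.
move=> p; rewrite /p /p47 !(coefD, coefC, coefZ, coefXn) /=.
by rewrite !(mulr0, mulr1, addr0, add0r).
Qed.

Lemma tc_p47 U f c0 c4 c5 c6 c7 : open U -> U 0 -> smooth U f -> tay 8 f (p47 c0 c4 c5 c6 c7) ->
  [/\ {in [:: 1; 2; 3]%N, forall n, tc f n = 0}, tc f 4 = c4, tc f 5 = c5, tc f 6 = c6 & tc f 7 = c7].
Proof.
move=> oU U0 sf Hf; have [[_ q1 q2 q3] [q4 q5 q6 q7]] := coef_p47 c0 c4 c5 c6 c7.
split; rewrite ?(tc_tay oU U0 sf Hf) //.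
by move=> n; rewrite !inE => /or3P[] /eqP ->; rewrite (tc_tay oU U0 sf Hf).
Qed.

Definition p811 (d0 d4 d5 d8 d9 d10 d11 : R) : {poly R} :=
  d0%:P + d4 *: 'X^4 + d5 *: 'X^5 + d8 *: 'X^8 + d9 *: 'X^9 + d10 *: 'X^10 + d11 *: 'X^11.

(** Below order 12 this substitution adds [4a t^10 + 4b t^11] to [t^4] and [5a t^11] to [t^5], and
    leaves the powers from [t^6] on unchanged. The vanishing of [t^6] and [t^7] is preserved while
    [t^11] is adjusted by two parameters. *)
Definition tweak (a b : R) : {poly R} := 'X + a *: 'X^7 + b *: 'X^8.

Lemma horner_tweak a b t : (tweak a b).[t] = t + a * t ^+ 7 + b * t ^+ 8.
Proof. by rewrite /tweak !hornerD !hornerZ !hornerXn hornerX. Qed.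

Lemma horner_p811 d0 d4 d5 d8 d9 d10 d11 t : (p811 d0 d4 d5 d8 d9 d10 d11).[t] =
  d0 + d4 * t ^+ 4 + d5 * t ^+ 5 + d8 * t ^+ 8 + d9 * t ^+ 9 + d10 * t ^+ 10 + d11 * t ^+ 11.
Proof. by rewrite /p811 !hornerD hornerC !hornerZ !hornerXn. Qed.

Lemma Ot_horner_tweak a b n : Ot (n.+1 + 6) (fun t => (tweak a b).[t] ^+ n.+1 - t ^+ n.+1).
Proof.
have H1 : Ot 1 (horner (tweak a b)).
  have H := OtXM 1 (Ot_horner (1 + a *: 'X^6 + b *: 'X^7)).
  apply: Ot_eq H; apply: (@nearW _ (nbhs (0 : R))) => t.
  by rewrite horner_tweak !hornerD hornerC !hornerZ !hornerXn; ring.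
have H7 : Ot 7 (fun t => (tweak a b).[t] - t).
  have H := OtXM 7 (Ot_horner (a%:P + b *: 'X)).
  apply: Ot_eq H; apply: (@nearW _ (nbhs (0 : R))) => t.
  by rewrite horner_tweak hornerD hornerC hornerZ hornerX; ring.
elim: n => [|n IH].
  by apply: Ot_eq H7; apply: (@nearW _ (nbhs (0 : R))) => t; rewrite !expr1.
have K1 := OtM H1 IH; have K2 := OtM (Ot_X R n.+1) H7.
have E : (n.+1 + 7 = n.+2 + 6)%N by lia.
rewrite E in K2.
apply: Ot_eq (OtD K1 K2); apply: (@nearW _ (nbhs (0 : R))) => t.
by rewrite !exprS; ring.
Qed.

Lemma tay_tweak f a b d0 d4 d5 d8 d9 d10 d11 : tay 12 f (p811 d0 d4 d5 d8 d9 d10 d11) ->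
  tay 12 (fun t => f (tweak a b).[t])
    (p811 d0 d4 d5 d8 d9 (d10 + 4 * a * d4) (d11 + 4 * b * d4 + 5 * a * d5)).
Proof.
move=> Hf; have H1 : Ot 1 (horner (tweak a b)).
  have H := OtXM 1 (Ot_horner (1 + a *: 'X^6 + b *: 'X^7)).
  apply: Ot_eq H; apply: (@nearW _ (nbhs (0 : R))) => t.
  by rewrite horner_tweak !hornerD hornerC !hornerZ !hornerXn; ring.
have H := tay_comp Hf (tay_poly 12 (tweak a b)) H1.
have T n : (5 < n)%N -> Ot 12 (fun t => (tweak a b).[t] ^+ n - t ^+ n).
  by case: n => // n n5; apply: OtW (Ot_horner_tweak a b n); lia.
have c0 (c : R) g : Ot 12 g -> Ot 12 (fun t => c * g t).
  by move=> Hg; apply: (@OtM _ 0 12) => //; exact: Ot0_cst.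
have T4 : Ot 12 (fun t => (tweak a b).[t] ^+ 4 - (t ^+ 4 + 4 * a * t ^+ 10 + 4 * b * t ^+ 11)).
  (* With [s = t^6 (a + b t)] the argument is [t (1 + s)]. This is [t^4] times the part of
     [(1 + s)^4] from [s^2] on, divided by [t^12]; the fifth power is treated alike, with [5 b t^12]
     left over. *)
  have H4 := OtXM 12 (Ot_horner (('X ^+ 4 * (a%:P + b%:P * 'X) ^+ 2) * (6%:P + 4%:P * ('X ^+ 6 * (a%:P + b%:P * 'X)) + ('X ^+ 6 * (a%:P + b%:P * 'X)) ^+ 2))).
  apply: Ot_eq H4; apply: (@nearW _ (nbhs (0 : R))) => t.
  rewrite horner_tweak !(hornerD, hornerM, horner_exp, hornerC, hornerX).
  by ring.
have T5 : Ot 12 (fun t => (tweak a b).[t] ^+ 5 - (t ^+ 5 + 5 * a * t ^+ 11)).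
  have H5 := OtXM 12 (Ot_horner ((5 * b)%:P + 'X ^+ 5 * (a%:P + b%:P * 'X) ^+ 2 * (10%:P + 10%:P * ('X ^+ 6 * (a%:P + b%:P * 'X)) + 5%:P * ('X ^+ 6 * (a%:P + b%:P * 'X)) ^+ 2 + ('X ^+ 6 * (a%:P + b%:P * 'X)) ^+ 3))).
  apply: Ot_eq H5; apply: (@nearW _ (nbhs (0 : R))) => t.
  rewrite horner_tweak !(hornerD, hornerM, horner_exp, hornerC, hornerX).
  by ring.
have HS := OtD (OtD (OtD (OtD (OtD (c0 d4 _ T4) (c0 d5 _ T5)) (c0 d8 _ (T 8%N isT)))
  (c0 d9 _ (T 9%N isT))) (c0 d10 _ (T 10%N isT))) (c0 d11 _ (T 11%N isT)).
apply: Ot_eq (OtD H HS); apply: (@nearW _ (nbhs (0 : R))) => t.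
rewrite horner_comp !horner_p811.
by move: ((tweak a b).[t]) (f _) => x y; ring.
Qed.

Lemma taylor811 U f : open U -> U 0 -> smooth U f ->
  {in [:: 1; 2; 3; 6; 7]%N, forall i, tc f i = 0} ->
  tay 12 f (p811 (tc f 0) (tc f 4) (tc f 5) (tc f 8) (tc f 9) (tc f 10) (tc f 11)).
Proof.
move=> oU U0 sf f0; apply: tay_horner_eq (taylor 12 oU U0 sf) => t.
rewrite horner_tpoly horner_p811.
have f1 := f0 1%N isT; have f2 := f0 2%N isT; have f3 := f0 3%N isT.
have f6 := f0 6%N isT; have f7 := f0 7%N isT.
move: (tc f) f1 f2 f3 f6 f7 => c f1 f2 f3 f6 f7.
by rewrite !big_ord_recr big_ord0 /= f1 f2 f3 f6 f7; ring.
Qed.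

Lemma coef_p811 (d0 d4 d5 d8 d9 d10 d11 : R) : let p := p811 d0 d4 d5 d8 d9 d10 d11 in
  [/\ {in [:: 1; 2; 3; 6; 7]%N, forall i, p`_i = 0}, p`_0 = d0, p`_4 = d4, p`_5 = d5 & p`_11 = d11].
Proof.
move=> p; rewrite /p /p811; split; last 4 first.
- by rewrite !(coefD, coefC, coefZ, coefXn) /= !(mulr0, mulr1, addr0, add0r).
- by rewrite !(coefD, coefC, coefZ, coefXn) /= !(mulr0, mulr1, addr0, add0r).
- by rewrite !(coefD, coefC, coefZ, coefXn) /= !(mulr0, mulr1, addr0, add0r).
- by rewrite !(coefD, coefC, coefZ, coefXn) /= !(mulr0, mulr1, addr0, add0r).
move=> i; rewrite !inE !(coefD, coefC, coefZ, coefXn).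
by move=> /or4P[|||/orP[]] /eqP -> /=; rewrite !(mulr0, addr0).
Qed.

End Reparametrisation.

(** * Necessity *)

Section Necessity.
Variable R : realType.
Notation e1 := (pt (1 : R) 0).
Notation e2 := (pt (0 : R) 1).

Lemma cusp45E (t : R) : cusp45 t = pt (t ^+ 4) (t ^+ 5).
Proof. by []. Qed.

(** Differentiating [P o G = id] along the lines through [z] shows that the product of the two
    Jacobian matrices is the identity, and determinants multiply. *)
Lemma jac_inverse (U W : set 'rV[R]_2) (P0 P1 G0 G1 : 'rV[R]_2 -> R) z : open W -> W z ->
  smooth U P0 -> smooth U P1 -> smooth W G0 -> smooth W G1 ->
  (forall y, W y -> U (pt (G0 y) (G1 y)) /\ pt (P0 (pt (G0 y) (G1 y))) (P1 (pt (G0 y) (G1 y))) = y) ->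
  jac G0 G1 z != 0.
Proof.
move=> oW Wz sP0 sP1 sG0 sG1 H.
have [Up _] := H z Wz; set p := pt (G0 z) (G1 z) in Up.
have [dP0 _] := sP0 1%N; have [dP1 _] := sP1 1%N.
have [dG0 _] := sG0 1%N; have [dG1 _] := sG1 1%N.
have chain (P : 'rV[R]_2 -> R) (i : 'I_2) (c d : R) : differentiable P p ->
    (forall y, W y -> P (pt (G0 y) (G1 y)) = y 0 i) ->
    'D_e1 P p * ('D_e1 G0 z * c + 'D_e2 G0 z * d) + 'D_e2 P p * ('D_e1 G1 z * c + 'D_e2 G1 z * d)
    = pt c d 0 i.
  move=> dP HP; pose l (x y s : R) := x + s * y.
  have dl (x y : R) : is_derive (0 : R) 1 (l x y) y.
    have h := is_derive_poly (x%:P + y *: 'X) 0.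
    rewrite derivD derivC derivZ derivX add0r hornerZ hornerC mulr1 in h.
    by apply: is_derive_near h; apply: (@nearW _ (nbhs (0 : R))) => s; rewrite /l !hornerE mulrC.
  pose c0 s := pt (l (z 0 0) c s) (l (z 0 1) d s).
  have E0 : c0 0 = z by rewrite /c0 /l !mul0r !addr0 ptK.
  have dG (G : 'rV[R]_2 -> R) : differentiable G z ->
      is_derive (0 : R) 1 (fun s => G (c0 s)) ('D_e1 G z * c + 'D_e2 G z * d).
    move=> dGz; have := @is_derive_pt _ G (l (z 0 0) c) (l (z 0 1) d) 0 c d.
    by rewrite -/(c0 0) E0 => /(_ dGz (dl _ _) (dl _ _)).
  have := @is_derive_pt _ P (fun s => G0 (c0 s)) (fun s => G1 (c0 s)) 0 _ _.
  rewrite E0 => /(_ _ _ dP (dG _ (dG0 _ Wz)) (dG _ (dG1 _ Wz))) D1.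
  have D2 : is_derive (0 : R) 1 (fun s => P (pt (G0 (c0 s)) (G1 (c0 s)))) (pt c d 0 i).
    have cc : {for (0 : R), continuous c0}.
      apply: differentiable_continuous.
      exact: (proj1 (diff_pt (is_derive_differentiable (dl _ _)) (is_derive_differentiable (dl _ _)))).
    have nW : \forall s \near (0 : R), W (c0 s).
      have : c0 s @[s --> (0 : R)] --> c0 0 := cc.
      by rewrite E0 => /(_ W); apply; exact: open_nbhs_nbhs.
    apply: (@is_derive_near _ (fun s => c0 s 0 i)).
      by apply: filterS nW => s Ws; rewrite HP.
    rewrite /c0 /pt; case: i {HP D1} => -[|[|//]] Hi.
      have -> : (fun s => (\row_(i0 < 2) (if val i0 == 0%N then l (z 0 0) c s else l (z 0 1) d s)) 0 (Ordinal Hi)) = l (z 0 0) c.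
        by apply/funext => s; rewrite mxE.
      by rewrite mxE.
    have -> : (fun s => (\row_(i0 < 2) (if val i0 == 0%N then l (z 0 0) c s else l (z 0 1) d s)) 0 (Ordinal Hi)) = l (z 0 1) d.
      by apply/funext => s; rewrite mxE.
    by rewrite mxE.
  by rewrite -(@derive_val _ _ _ _ _ _ _ D1) (@derive_val _ _ _ _ _ _ _ D2).
have HP0 y : W y -> P0 (pt (G0 y) (G1 y)) = y 0 0.
  by move=> /H[_ E]; rewrite -[LHS](pt0 _ (P1 (pt (G0 y) (G1 y)))) E.
have HP1 y : W y -> P1 (pt (G0 y) (G1 y)) = y 0 1.
  by move=> /H[_ E]; rewrite -[LHS](pt1 (P0 (pt (G0 y) (G1 y)))) E.
have := chain P0 0 1 0 (dP0 _ Up) HP0; have := chain P0 0 0 1 (dP0 _ Up) HP0.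
have := chain P1 1 1 0 (dP1 _ Up) HP1; have := chain P1 1 0 1 (dP1 _ Up) HP1.
rewrite /jac; move: ('D_e1 P0 p) ('D_e2 P0 p) ('D_e1 P1 p) ('D_e2 P1 p) => p00 p01 p10 p11.
move: ('D_e1 G0 z) ('D_e2 G0 z) ('D_e1 G1 z) ('D_e2 G1 z) => g00 g01 g10 g11.
rewrite !pt0 !pt1 !mulr1 !mulr0 !addr0 !add0r => E4 E3 E2 E1.
have K : (p00 * p11 - p01 * p10) * (g00 * g11 - g01 * g10) = 1.
  have -> : (p00 * p11 - p01 * p10) * (g00 * g11 - g01 * g10) =
    (p00 * g00 + p01 * g10) * (p10 * g01 + p11 * g11)
    - (p00 * g01 + p01 * g11) * (p10 * g00 + p11 * g10) by ring.
  by rewrite E1 E2 E3 E4 mulr1 mul0r subr0.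
by apply/eqP => J0; move: K; rewrite J0 mulr0 => /eqP; rewrite eq_sym oner_eq0.
Qed.

(** [u0, ..., u3] are the first Taylor coefficients of [psi(t) / t], and [(al i, be i)] is the
    differential at the origin of the i-th coordinate of the inverse of [Psi]. *)
Lemma A_equiv0_jet (I : set R) (gam : R -> 'rV[R]_2) : open I -> I 0 -> smooth_on I gam ->
  A_equiv0 gam (@cusp45 R) ->
  exists (u0 u1 u2 u3 : R) (al be : 'I_2 -> R),
    [/\ u0 != 0, al 0 * be 1 - be 0 * al 1 != 0 &
    forall i, let f t := gam t 0 i in
     [/\ {in [:: 1; 2; 3]%N, forall n, tc f n = 0}, tc f 4 = al i * u0 ^+ 4,
      tc f 5 = al i * (4 * u0 ^+ 3 * u1) + be i * u0 ^+ 5,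
      tc f 6 = al i * (4 * u0 ^+ 3 * u2 + 6 * u0 ^+ 2 * u1 ^+ 2) + be i * (5 * u0 ^+ 4 * u1) &
      tc f 7 = al i * (4 * u0 ^+ 3 * u3 + 12 * u0 ^+ 2 * u1 * u2 + 4 * u0 * u1 ^+ 3)
         + be i * (5 * u0 ^+ 4 * u2 + 10 * u0 ^+ 3 * u1 ^+ 2)]].
Proof.
move=> oI I0 sg [psi [psii [Psi [[U [W [[oU oW] U0 [spsi spsii] HU HW]]] psi0
  [G [U' [W' [[oU' oW'] U'0 [sPsi sG] HU' HW']]]] Heq]]]].
have {}spsi := smooth_of_on1 spsi; have {}spsii := smooth_of_on1 spsii.
have W0 : W 0 by have [] := HU 0 U0; rewrite psi0.
have psii0 : psii 0 = 0 by have [_] := HU 0 U0; rewrite psi0.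
have nU : \forall t \near (0 : R), U t by exact: open_nbhs_nbhs.
have cpsi : psi t @[t --> (0 : R)] --> (0 : R).
  by rewrite -[X in _ --> X]psi0; exact: (Ck_cont (spsi 0%N) U0).
have nH : \forall t \near (0 : R), Psi (gam t) = cusp45 (psi t).
  have H1 := cpsi _ Heq.
  near=> t; have Ut : U t by near: t.
  have [_ E] := HU t Ut; rewrite -{1}E; near: t; exact: H1.
have cgam : gam t @[t --> (0 : R)] --> gam 0 by have [] := sg [::] 0 I0.
have nU' : \forall t \near (0 : R), U' (gam t) by apply: cgam; exact: open_nbhs_nbhs.
have Z : Psi (gam 0) = pt 0 0.
  by rewrite (nbhs_singleton nH) psi0 cusp45E !expr0n.
have W'0 : W' (pt 0 0) by rewrite -Z; have [] := HU' _ U'0.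
have ngam : \forall t \near (0 : R), gam t = G (pt (psi t ^+ 4) (psi t ^+ 5)).
  near=> t; have Ut : U' (gam t) by near: t.
  have [_ <-] := HU' _ Ut; rewrite -cusp45E; congr G; near: t.
  exact: nH.
pose Gi (i : 'I_2) z := G z 0 i.
have sGi i : smooth W' (Gi i) by apply: smooth_of_on2 => //; exact: smooth_on_coord.
have sPi i : smooth U' (fun z => Psi z 0 i) by apply: smooth_of_on2 => //; exact: smooth_on_coord.
have J : jac (Gi 0) (Gi 1) (pt 0 0) != 0.
  apply: (@jac_inverse U' W' (fun z => Psi z 0 0) (fun z => Psi z 0 1)) => // y Wy.
  by rewrite /Gi !ptK; have [] := HW' y Wy.
pose v : {poly R} := \poly_(i < 7) tc psi i.+1.
have Tpsi : tay 8 psi ('X * v).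
  apply: tay_horner_eq (taylor 8 oU U0 spsi) => t.
  rewrite horner_tpoly hornerM hornerX horner_poly big_ord_recl /= {1}/tc /= psi0 !mul0r add0r.
  by rewrite mulr_sumr; apply: eq_bigr => i _; rewrite exprS mulrCA.
have Jv : j4 (horner v) (tc psi 1) (tc psi 2) (tc psi 3) (tc psi 4).
  have H := OtXM 4 (Ot0_cubic (tc psi 5) (tc psi 6) (tc psi 7) 0).
  apply: Ot_eq H; apply: (@nearW _ (nbhs (0 : R))) => t.
  rewrite horner_poly; move: (tc psi) => c.
  by rewrite !big_ord_recr big_ord0 /=; ring.
exists (tc psi 1), (tc psi 2), (tc psi 3), (tc psi 4).
exists (fun i => 'D_e1 (Gi i) (pt 0 0)), (fun i => 'D_e2 (Gi i) (pt 0 0)); split; [|exact: J|].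
  have h1 := smooth_is_derive spsi U0.
  have h2 : is_derive (psi 0) 1 psii ('D_1 psii (psi 0)).
    by apply: (smooth_is_derive spsii); rewrite psi0.
  have h3 := is_derive_comp1 h1 h2.
  have h4 : is_derive (0 : R) 1 (fun t => psii (psi t)) 1.
    have E : \forall t \near (0 : R), id t = psii (psi t) by apply: filterS nU => t /HU[_ ->].
    exact: (is_derive_near E (is_derive_id (0 : R) 1)).
  have E : 'D_1 psii (psi 0) * 'D_1 psi 0 = 1.
    by rewrite -(@derive_val _ _ _ _ _ _ _ h3) (@derive_val _ _ _ _ _ _ _ h4).
  rewrite /tc /= divr1; apply/eqP => E0; move: E; rewrite E0 mulr0 => /eqP.
  by rewrite eq_sym oner_eq0.
move=> i f.
have sf : smooth I f by apply: smooth_of_on1; exact: smooth_on_coord.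
have Hd : tay 8 (fun s => Gi i (pt (s ^+ 4) (s ^+ 5)))
   (p47 (Gi i (pt 0 0)) ('D_e1 (Gi i) (pt 0 0)) ('D_e2 (Gi i) (pt 0 0)) 0 0).
  apply: tay_horner_eq (cusp_expand oW' W'0 (sGi i 2%N)) => t.
  rewrite horner_p47 !hornerD hornerC !hornerZ !hornerXn.
  move: (Gi i (pt 0 0)) ('D_e1 (Gi i) _) ('D_e2 (Gi i) _) => x y w; ring.
have Hc := tay_p47_comp Hd Tpsi Jv.
have Ef : \forall t \near (0 : R), Gi i (pt (psi t ^+ 4) (psi t ^+ 5)) = f t.
  by apply: filterS ngam => t; rewrite /f => ->.
have Hf := tay_eq Ef Hc.
have [q0 q4 q5 q6 q7] := tc_p47 oI I0 sf Hf.
by split; rewrite ?q4 ?q5 ?q6 ?q7 ?mul0r ?addr0.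
Unshelve. all: by end_near. Qed.

End Necessity.

(** * Sufficiency *)

Section Sufficiency.
Variable R : realType.
Implicit Types (f g : R -> R) (U : set R).
Notation e1 := (pt (1 : R) 0).
Notation e2 := (pt (0 : R) 1).

Lemma smooth_horner U (p : {poly R}) : open U -> smooth U (horner p).
Proof.
move=> oU; elim/poly_ind: p => [|p c IH] k.
  by apply: Ck_eq (Ck_cst k U 0) => // t _; rewrite horner0.
apply: Ck_eq (CkD oU (CkM oU (IH k) (Ck_id k U)) (Ck_cst k U c)) => // t _.
by rewrite hornerMXaddC.
Qed.

Lemma smooth_comp_poly U f (p : {poly R}) : open U -> smooth U f ->
  open [set t | U p.[t]] /\ smooth [set t | U p.[t]] (fun t => f p.[t]).
Proof.
move=> oU sf; have oV : open [set t | U p.[t]].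
  by apply: (@open_comp _ _ (horner p)) => // t _; exact: continuous_horner.
split=> // k; apply: (@Ck_comp1 _ _ _ _ U) => //.
exact: smooth_horner.
Qed.

(* The two coordinates satisfy [c6 = p6 c4 + q6 c5] and [c7 = p7 c4 + q7 c5]; the reparametrisation
   [t + th2 t^2 + th3 t^3 + th4 t^4] is chosen to cancel the coefficients of [t^6] and [t^7] along
   [c4], and the relation between [p6], [q6], [q7] is what makes the one along [c5] vanish too. *)
Lemma kill_67 (c : 'I_2 -> nat -> R) : let d m n := c 0 m * c 1 n - c 1 m * c 0 n in
  d 5 4 != 0 -> - 22 * d 6 4 ^+ 2 + 25 * d 6 5 * d 5 4 + 20 * d 7 4 * d 5 4 = 0 ->
  exists u1 u2 u3 : R, forall i,
    c i 4 * (4 * u2 + 6 * u1 ^+ 2) + c i 5 * (5 * u1) + c i 6 = 0 /\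
    c i 4 * (4 * u3 + 12 * u1 * u2 + 4 * u1 ^+ 3) + c i 5 * (5 * u2 + 10 * u1 ^+ 2)
      + c i 6 * (6 * u1) + c i 7 = 0.
Proof.
move=> d K0 H; set K := d 5 4 in K0 H.
pose q6 := d 6 4 / K; pose p6 := - d 6 5 / K; pose q7 := d 7 4 / K; pose p7 := - d 7 5 / K.
have E6 i : c i 6 = p6 * c i 4 + q6 * c i 5.
  rewrite /p6 /q6 /K /d in K0 *; move: K0.
  case: i => -[|[|//]] Hi; [rewrite (_ : Ordinal Hi = 0)|rewrite (_ : Ordinal Hi = 1)]; try exact/val_inj.
    by move=> K0; field.
  by move=> K0; field.
have E7 i : c i 7 = p7 * c i 4 + q7 * c i 5.
  rewrite /p7 /q7 /K /d in K0 *; move: K0.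
  case: i => -[|[|//]] Hi; [rewrite (_ : Ordinal Hi = 0)|rewrite (_ : Ordinal Hi = 1)]; try exact/val_inj.
    by move=> K0; field.
  by move=> K0; field.
have Hq : - 22 * q6 ^+ 2 - 25 * p6 + 20 * q7 = 0.
  have -> : - 22 * q6 ^+ 2 - 25 * p6 + 20 * q7 =
     (- 22 * d 6 4 ^+ 2 + 25 * d 6 5 * K + 20 * d 7 4 * K) / K ^+ 2.
    have aux (x y z k : R) : k != 0 -> - 22 * (x / k) ^+ 2 - 25 * (- y / k) + 20 * (z / k) =
        (- 22 * x ^+ 2 + 25 * y * k + 20 * z * k) / k ^+ 2 by move=> k0; field.
    exact: aux.
  by rewrite H mul0r.
have Eq7 : q7 = (22 * q6 ^+ 2 + 25 * p6) / 20.
  by apply: (mulIf (_ : 20 != 0 :> R)); rewrite ?divfK ?pnatr_eq0 //; lra.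
(* The [c5] part of [t^6] fixes [th2], its [c4] part fixes [th3], and the [c4] part of [t^7] fixes
   [th4]. The [c5] part of [t^7] is then [q7 - (5/4) p6 - (11/10) q6^2], zero by [Eq7]. *)
pose th2 := - q6 / 5; pose th3 := - (p6 + 6 * th2 ^+ 2) / 4.
pose th4 := - (p7 + 6 * th2 * p6 + 12 * th2 * th3 + 4 * th2 ^+ 3) / 4.
exists th2, th3, th4 => i; rewrite E7 E6 Eq7 /th4 /th3 /th2.
move: (c i 4) (c i 5) => x y; clear -x y; move: q6 p6 p7 => q p p'.
by split; field.
Qed.

(** Cramer's rule for a linear system in [4b] and [5a] whose columns are the coefficient vectors of
    [t^4] and [t^5]. *)
Lemma kill_11 (d : 'I_2 -> nat -> R) : d 0 5 * d 1 4 - d 1 5 * d 0 4 != 0 ->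
  exists a b : R, forall i, d i 11 + 4 * b * d i 4 + 5 * a * d i 5 = 0.
Proof.
move=> K0.
exists (- (d 0 11 * d 1 4 - d 1 11 * d 0 4) / (d 0 5 * d 1 4 - d 1 5 * d 0 4) / 5).
exists ((d 0 11 * d 1 5 - d 1 11 * d 0 5) / (d 0 5 * d 1 4 - d 1 5 * d 0 4) / 4).
move=> i; move: K0; case: i => -[|[|//]] Hi; [rewrite (_ : Ordinal Hi = 0)|rewrite (_ : Ordinal Hi = 1)]; try exact/val_inj.
  by move: (d 0 11) (d 1 11) (d 0 4) (d 1 4) (d 0 5) (d 1 5) => x11 y11 x4 y4 x5 y5 K0; field.
by move: (d 0 11) (d 1 11) (d 0 4) (d 1 4) (d 0 5) (d 1 5) => x11 y11 x4 y4 x5 y5 K0; field.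
Qed.

Definition eta (u1 u2 u3 : R) : {poly R} := 'X * (1 + u1 *: 'X + u2 *: 'X^2 + u3 *: 'X^3).

Lemma reparametrise_67 U f u1 u2 u3 : open U -> U 0 -> smooth U f ->
  {in [:: 1; 2; 3]%N, forall n, tc f n = 0} ->
  tc f 4 * (4 * u2 + 6 * u1 ^+ 2) + tc f 5 * (5 * u1) + tc f 6 = 0 ->
  tc f 4 * (4 * u3 + 12 * u1 * u2 + 4 * u1 ^+ 3) + tc f 5 * (5 * u2 + 10 * u1 ^+ 2)
      + tc f 6 * (6 * u1) + tc f 7 = 0 ->
  let h t := f (eta u1 u2 u3).[t] in
  [/\ {in [:: 1; 2; 3; 6; 7]%N, forall n, tc h n = 0}, tc h 4 = tc f 4 &
      tc h 5 = tc f 4 * (4 * u1) + tc f 5].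
Proof.
move=> oU U0 sf f0 H6 H7 h.
have [oV sh] := smooth_comp_poly (eta u1 u2 u3) oU sf.
have V0 : [set t | U (eta u1 u2 u3).[t]] 0 by rewrite /= /eta hornerM hornerX mul0r.
have Hf := taylor47 oU U0 sf f0.
have Ju : j4 (horner (1 + u1 *: 'X + u2 *: 'X^2 + u3 *: 'X^3)) 1 u1 u2 u3.
  by apply: Ot_zero => t; rewrite !hornerD hornerC !hornerZ !hornerXn hornerX; ring.
have H := tay_p47_comp Hf (tay_poly 8 _) Ju.
have [q0 q4 q5 q6 q7] := tc_p47 oV V0 sh H.
split; last 2 first.
- by rewrite /h q4; ring.
- by rewrite /h q5; ring.
move=> n; rewrite !inE => /or4P[/eqP ->|/eqP ->|/eqP ->|/orP[] /eqP ->].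
- exact: q0.
- exact: q0.
- exact: q0.
- by rewrite /h q6 -[RHS]H6; ring.
- by rewrite /h q7 -[RHS]H7; ring.
Qed.

Lemma reparametrise_11 U f a b : open U -> U 0 -> smooth U f ->
  {in [:: 1; 2; 3; 6; 7]%N, forall n, tc f n = 0} ->
  tc f 11 + 4 * b * tc f 4 + 5 * a * tc f 5 = 0 ->
  let h t := f (tweak a b).[t] in
  [/\ {in [:: 1; 2; 3; 6; 7; 11]%N, forall n, tc h n = 0}, tc h 4 = tc f 4 & tc h 5 = tc f 5].
Proof.
move=> oU U0 sf f0 H11 h.
have [oV sh] := smooth_comp_poly (tweak a b) oU sf.
have V0 : [set t | U (tweak a b).[t]] 0 by rewrite /= horner_tweak !expr0n !mulr0 !addr0.
have H := tay_tweak a b (taylor811 oU U0 sf f0).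
have T n : (n < 12)%N -> tc h n = _ := tc_tay oV V0 sh H.
have [q0 _ q4 q5 q11] := coef_p811 (tc f 0) (tc f 4) (tc f 5) (tc f 8) (tc f 9)
  (tc f 10 + 4 * a * tc f 4) (tc f 11 + 4 * b * tc f 4 + 5 * a * tc f 5).
split; [|by rewrite T // q4|by rewrite T // q5].
move=> n; rewrite !inE => /or4P[/eqP ->|/eqP ->|/eqP ->|/or3P[] /eqP ->]; rewrite T //.
- exact: q0.
- exact: q0.
- exact: q0.
- exact: q0.
- exact: q0.
- by rewrite q11.
Qed.

Lemma A_equiv0_of_jet (I : set R) (gam : R -> 'rV[R]_2) : open I -> I 0 -> smooth_on I gam ->
  let c (i : 'I_2) := tc (fun t => gam t 0 i) in
  let d m n := c 0 m * c 1 n - c 1 m * c 0 n in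
  (forall i, {in [:: 1; 2; 3]%N, forall n, c i n = 0}) ->
  d 5 4 != 0 -> - 22 * d 6 4 ^+ 2 + 25 * d 6 5 * d 5 4 + 20 * d 7 4 * d 5 4 = 0 ->
  A_equiv0 gam (@cusp45 R).
Proof.
move=> oI I0 sg c d c0 K0 Hd.
have sf i : smooth I (fun t => gam t 0 i) by apply: smooth_of_on1; exact: smooth_on_coord.
have [u1 [u2 [u3 Hu]]] := kill_67 K0 Hd.
set et := eta u1 u2 u3.
have [oI1 sh] : open [set t | I et.[t]] /\ forall i, smooth [set t | I et.[t]] (fun t => gam et.[t] 0 i).
  split; first by have [] := smooth_comp_poly et oI (sf 0).
  by move=> i; have [_] := smooth_comp_poly et oI (sf i).
have et0 : et.[0] = 0 by rewrite /et /eta hornerM hornerX mul0r.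
have I10 : [set t | I et.[t]] 0 by rewrite /= et0.
have Hh i := reparametrise_67 oI I0 (sf i) (c0 i) (proj1 (Hu i)) (proj2 (Hu i)).
pose h i := tc (fun t => gam et.[t] 0 i).
have [a [b Hab]] : exists a b : R, forall i, h i 11 + 4 * b * h i 4 + 5 * a * h i 5 = 0.
  apply: kill_11; rewrite /h.
  have [_ -> ->] := Hh 0; have [_ -> ->] := Hh 1; rewrite -!/(c _).
  move: K0; rewrite /d; move: (c 0 4) (c 1 4) (c 0 5) (c 1 5) => x4 y4 x5 y5.
  (* The first reparametrisation adds to the vector of [t^5] a multiple of that of [t^4], so their
     determinant does not change. *)
  have -> : (x4 * (4 * u1) + x5) * y4 - (y4 * (4 * u1) + y5) * x4 = x5 * y4 - y5 * x4 by ring.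
  by [].
set tw := tweak a b.
have tw0 : tw.[0] = 0 by rewrite /tw horner_tweak !expr0n !mulr0 !addr0.
pose J := [set t | [set t | I et.[t]] tw.[t]].
have [oJ sk] : open J /\ forall i, smooth J (fun t => gam et.[tw.[t]] 0 i).
  split; first by have [] := smooth_comp_poly tw oI1 (sh 0).
  by move=> i; have [_] := smooth_comp_poly tw oI1 (sh i).
have J0 : J 0 by rewrite /J /= tw0 et0.
have Hk i : [/\ {in [:: 1; 2; 3; 6; 7; 11]%N, forall n, tc (fun t => gam et.[tw.[t]] 0 i) n = 0},
    tc (fun t => gam et.[tw.[t]] 0 i) 4 = h i 4 & tc (fun t => gam et.[tw.[t]] 0 i) 5 = h i 5].
  have [h0 _ _] := Hh i.
  exact: (reparametrise_11 oI1 I10 (sh i) h0 (Hab i)).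
have Fac i : exists (V : set 'rV[R]_2) F, [/\ open V, V (pt 0 0), smooth V F &
   \forall t \near (0 : R), F (pt (t ^+ 4) (t ^+ 5)) = gam et.[tw.[t]] 0 i].
  apply: (semigroup_factor oJ J0 (sk i)) => n Hn.
  by have [k0 _ _] := Hk i; rewrite dn_tc k0 // mulr0.
have DF i V F : open V -> V (pt 0 0) -> smooth V F ->
   (\forall t \near (0 : R), F (pt (t ^+ 4) (t ^+ 5)) = gam et.[tw.[t]] 0 i) ->
   'D_e1 F (pt 0 0) = h i 4 /\ 'D_e2 F (pt 0 0) = h i 5.
  move=> oV V0 sF HF; have H := tay_eq HF (cusp_expand oV V0 (sF 2%N)).
  have H8 : tay 8 (fun t => gam et.[tw.[t]] 0 i)
      (p47 (F (pt 0 0)) ('D_e1 F (pt 0 0)) ('D_e2 F (pt 0 0)) 0 0).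
    apply: tay_horner_eq H => t; rewrite horner_p47 !hornerD hornerC !hornerZ !hornerXn.
    by move: (F (pt 0 0)) ('D_e1 F _) ('D_e2 F _) => x y z; ring.
  have [_ <- <- _ _] := tc_p47 oJ J0 (sk i) H8.
  by have [_ -> ->] := Hk i.
have [V0 [F0 [oV0 V00 sF0 E0]]] := Fac 0; have [V1 [F1 [oV1 V10 sF1 E1]]] := Fac 1.
have [D00 D01] := DF 0 _ _ oV0 V00 sF0 E0; have [D10 D11] := DF 1 _ _ oV1 V10 sF1 E1.
pose V := V0 `&` V1; have oV : open V by exact: openI.
have VV : V (pt 0 0) by split.
have s0 : smooth V F0 by move=> k; apply: CkS (sF0 k) => z [].
have s1 : smooth V F1 by move=> k; apply: CkS (sF1 k) => z [].
have Jn : jac F0 F1 (pt 0 0) != 0.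
  rewrite /jac D00 D01 D10 D11 /h.
  have [_ -> ->] := Hh 0; have [_ -> ->] := Hh 1; rewrite -!/(c _).
  move: K0; rewrite /d; move: (c 0 4) (c 1 4) (c 0 5) (c 1 5) => x4 y4 x5 y5.
  have -> : x4 * (y4 * (4 * u1) + y5) - (x4 * (4 * u1) + x5) * y4 = - (x5 * y4 - y5 * x4) by ring.
  by rewrite oppr_eq0.
have [U' [W' [G0 [G1 [oU' oW' U'0 UV [sG0 sG1 HU HW]]]]]] := inverse_map2 oV VV s0 s1 Jn.
pose th := et \Po tw.
have thE t : th.[t] = et.[tw.[t]] by rewrite /th horner_comp.
have dth : 'D_1 (horner th) 0 != 0.
  have hd := is_derive_poly th 0; rewrite (@derive_val _ _ _ _ _ _ _ hd).
  rewrite /th deriv_comp hornerM horner_comp tw0 /et /eta /tw /tweak.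
  rewrite derivM derivX mul1r !derivD derivX !derivZ !derivXn.
  rewrite !(hornerD, hornerM, hornerX, hornerC, hornerZ, hornerMn, hornerXn) !expr0n /=.
  by rewrite !(mulr0, mul0r, addr0, mulr1) oner_neq0.
have [Ut [Wt [g [oUt oWt Ut0 _ [sgg HUt HWt]]]]] := inverse_map1 openT Logic.I (smooth_horner th openT) dth.
have th0 : th.[0] = 0 by rewrite thE tw0 et0.
have nE : \forall t \near (0 : R), pt (F0 (pt (t ^+ 4) (t ^+ 5))) (F1 (pt (t ^+ 4) (t ^+ 5))) = gam th.[t].
  by near=> t; rewrite thE -[RHS]ptK; congr pt; near: t.
have P0 : pt (F0 (pt 0 0)) (F1 (pt 0 0)) = gam 0.
  by have := nbhs_singleton nE; rewrite th0 !expr0n.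
(* [A_equiv0] composes the curve with the inverse of [psi], so [th] takes the place of [psiinv] and
   its local inverse that of [psi]; likewise [Psi] is the inverse of the map through which the curve
   factors. *)
exists g, (horner th), (fun z => pt (G0 z) (G1 z)); split.
- exists Wt, Ut; split => //.
  + by have [] := HUt _ Ut0; rewrite th0.
  + split; first exact: smooth_on_of.
    by apply: smooth_on_of; exact: smooth_horner.
- by have [_] := HUt _ Ut0; rewrite th0.
- exists (fun z => pt (F0 z) (F1 z)), W', U'; split => //.
  + by rewrite -P0; have [] := HU _ U'0.
  + split; first exact: smooth_on_pt.
    apply: smooth_on_pt => // k; [exact: CkS UV (s0 k)|exact: CkS UV (s1 k)].
- have nU := near_cusp oU' U'0.
  near=> s; have Us : U' (pt (s ^+ 4) (s ^+ 5)) by near: s.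
  have [_ E] := HU _ Us; rewrite cusp45E -[RHS]E; near: s.
  by apply: filterS nE => t ->.
Unshelve. all: by end_near. Qed.

End Sufficiency.

(** * The criterion in terms of derivatives at 0 *)

Unset Implicit Arguments.

Theorem mainTheorem8 (R : realType) (a b : R) (gam : R -> 'rV[R]_2) :
  a < 0 < b -> smooth_on [set t | a < t < b] gam ->
  let A := det2 (kder 5 gam 0) (kder 4 gam 0) in
  let B := det2 (kder 6 gam 0) (kder 4 gam 0) in
  let C := det2 (kder 7 gam 0) (kder 4 gam 0) in
  let D := det2 (kder 6 gam 0) (kder 5 gam 0) in
  (A_equiv0 gam (@cusp45 R) <->
   [/\ kder 1 gam 0 = 0, kder 2 gam 0 = 0, kder 3 gam 0 = 0, A != 0 &
       - 77 * B ^+ 2 + 105 * A * D + 60 * A * C = 0]).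
Proof.
move=> /andP[a0 b0] sg A B C D; set I := [set t | a < t < b] in sg.
have oI : open I.
  have -> : I = `]a, b[%classic by apply/seteqP; split => t; rewrite /= in_itv.
  exact: itv_open.
have I0 : I 0 by apply/andP.
pose c (i : 'I_2) := tc (fun t => gam t 0 i).
pose d m n := c 0 m * c 1 n - c 1 m * c 0 n.
have kc n i : kder n gam 0 0 i = n`!%:R * c i n by rewrite (kder_coord i n oI sg I0) dn_tc.
have det m n : det2 (kder m gam 0) (kder n gam 0) = m`!%:R * n`!%:R * d m n.
  by rewrite /det2 !kc /d; ring.
have EA : A = 120 * 24 * d 5 4 by rewrite /A det.
have EB : B = 720 * 24 * d 6 4 by rewrite /B det.
have EC : C = 5040 * 24 * d 7 4 by rewrite /C det.
have ED : D = 720 * 120 * d 6 5 by rewrite /D det.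
have E0 n : kder n gam 0 = 0 <-> forall i, c i n = 0.
  have n0 : n`!%:R != 0 :> R by rewrite pnatr_eq0 -lt0n fact_gt0.
  split=> [E i|E]; first by apply: (mulfI n0); rewrite -kc E mxE mulr0.
  by apply/rowP => i; rewrite kc E mulr0 mxE.
split=> [/(A_equiv0_jet oI I0 sg)[u0 [u1 [u2 [u3 [al [be [u00 J H]]]]]]]|[k1 k2 k3 A0 cond]].
  have [z0 c04 c05 c06 c07] := H 0; have [z1 c14 c15 c16 c17] := H 1.
  rewrite -!/(c _) in z0 c04 c05 c06 c07 z1 c14 c15 c16 c17.
  have Z n : n \in [:: 1; 2; 3]%N -> kder n gam 0 = 0.
    by move=> Hn; apply/E0 => i; have [z _ _ _ _] := H i; exact: z.
  have E54 : d 5 4 = - (u0 ^+ 9 * (al 0 * be 1 - be 0 * al 1)).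
    by rewrite /d c04 c05 c14 c15; ring.
  split; [exact: Z|exact: Z|exact: Z| |].
    by rewrite EA E54 !mulf_neq0 ?pnatr_eq0 // oppr_eq0 mulf_neq0 // expf_neq0.
  rewrite EA EB EC ED /d c04 c05 c06 c07 c14 c15 c16 c17.
  move: (al 0) (al 1) (be 0) (be 1) => x y z w; ring.
have d54 : d 5 4 != 0 by apply: contraNneq A0 => E; rewrite EA E mulr0.
apply: (A_equiv0_of_jet oI I0 sg) => //.
  by move=> i n; rewrite !inE => /or3P[] /eqP ->; apply: (E0 _).1.
rewrite -!/(c _) -!/(d _ _).
move: cond; rewrite EA EB EC ED; move: (d 5 4) (d 6 4) (d 7 4) (d 6 5) => x y z w cond.
(* The common factor of [77 (6! 4!)^2], [105 (5! 4!) (6! 5!)] and [60 (5! 4!) (7! 4!)], with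
   quotients 22, 25 and 20. *)
have : (3 * 5 * 7 * 120 * 24 * 24 * 144 : R) * (- 22 * y ^+ 2 + 25 * w * x + 20 * z * x) = 0 by rewrite -[RHS]cond; ring.
by move/eqP; rewrite !mulf_eq0 !pnatr_eq0 /= => /eqP.
Qed.
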